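(* Let $T>0$, let $X$ solve the $d$-dimensional Itô SDE $$X(t)=X_0+\int_{0}^{t}\mu(X(s))\,ds+\sum_{j=1}^m\int_{0}^{t}\sigma_j(X(s))\,dW_j(s),\qquad 0\le t\le T,$$ driven by an $m$-dimensional standard Wiener process $W=(W_1,\dots,W_m)$, with deterministic $X_0\in\mathbb{R}^d$. Fix a finest level $L\ge 1$ and use the weak (binomial) increments, the coupled weak Milstein scheme without Lévy areas, and the antithetic fine/coarse payoffs described in the context. Let $f:\mathbb{R}^d\to\mathbb{R}$ be Lipschitz continuous and in $C^2(\mathbb{R}^d,\mathbb{R})$. Then there is a constant $C$, independent of $l$ and of $L$, such that for all $1\le l\le L$ $$\operatorname{Var}\big(\hat P^f_l-\hat P^c_{l-1}\big)\le \mathbb{E}\big[(\hat P^f_l-\hat P^c_{l-1})^2\big]\le C\,\Delta_l^{2},$$ i.e. the multilevel correction variance decays with order $\beta=2$.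
   Context: Standing assumptions: $\mu:\mathbb{R}^d\to\mathbb{R}^d$ and each $\sigma_j:\mathbb{R}^d\to\mathbb{R}^d$ ($j=1,\dots,m$) are in $C^2$ (as in the setting of Giles–Szpruch's antithetic MLMC, they are taken globally Lipschitz with bounded first and second derivatives); $f$ is Lipschitz and $C^2$ (with bounded second derivatives). $\sigma_j'$ denotes the Jacobian matrix of $\sigma_j$. Step sizes: $\Delta_l=2^{-l}T$, $l=0,\dots,L$; level $l$ uses $N_l=2^l$ steps. Weak increments: let $\xi^f_{L,i,j}$, $i=1,\dots,2^L$, $j=1,\dots,m$, be i.i.d. with $\mathbb{P}(\xi^f_{L,i,j}=\sqrt{\Delta_L})=\mathbb{P}(\xi^f_{L,i,j}=-\sqrt{\Delta_L})=\tfrac12$. For $l<L$ define the fine increments at level $l$ by summing consecutive finest increments: $\xi^f_{l,i}=\sum_{r=(i-1)2^{L-l}+1}^{i\,2^{L-l}}\xi^f_{L,r}\in\mathbb{R}^m$, $i=1,\dots,2^l$; equivalently each component is distributed as $(\mathrm{Bin}(2^{L-l},\tfrac12)-2^{L-l-1})\cdot 2\sqrt{\Delta_L}$. Coarse increments for the level-$l$ correction are coupled by $\xi^c_{l-1,i}=\xi^f_{l,2i-1}+\xi^f_{l,2i}$, $i=1,\dots,2^{l-1}$ (so $\xi^c_{l-1,i}$ has the same law as $\xi^f_{l-1,i}$). Antithetic increments: $\xi^a_{l,2i-1}=\xi^f_{l,2i}$, $\xi^a_{l,2i}=\xi^f_{l,2i-1}$ for all $i$. Weak Milstein scheme without Lévy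 areas at level $k$ with increments $\xi_{k,\cdot}$ (here $\xi_{k,i,j}$ is the $j$-th component): $X_{k,0}=X_0$ and for $i=1,\dots,2^k$ $$X_{k,i}=X_{k,i-1}+\mu(X_{k,i-1})\Delta_k+\sum_{j=1}^m\sigma_j(X_{k,i-1})\,\xi_{k,i,j}+\frac12\sum_{j,k'=1}^m\sigma_j'(X_{k,i-1})\sigma_{k'}(X_{k,i-1})\big(\xi_{k,i,j}\xi_{k,i,k'}-\delta_{jk'}\Delta_k\big).$$ $X^f_{l,\cdot}$, $X^a_{l,\cdot}$ are this scheme at level $l$ with increments $\xi^f_{l,\cdot}$, $\xi^a_{l,\cdot}$ respectively, and $X^c_{l-1,\cdot}$ is the scheme at level $l-1$ with increments $\xi^c_{l-1,\cdot}$ (all built from the same underlying finest increments). Antithetic payoffs: $\hat P^f_l=\tfrac12\big(f(X^f_{l,2^l})+f(X^a_{l,2^l})\big)$ and $\hat P^c_{l-1}=f(X^c_{l-1,2^{l-1}})$. *)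

(* Defs.v *)
From Stdlib Require Import Reals.
From mathcomp Require Import all_boot.
Set Implicit Arguments. Unset Strict Implicit. Unset Printing Implicit Defensive.

Local Open Scope R_scope.


Definition vec (d : nat) := 'I_d -> R.

Definition vadd d (x y : vec d) : vec d := fun i => x i + y i.
Definition vsub d (x y : vec d) : vec d := fun i => x i - y i.
Definition vnorm d (x : vec d) : R := sqrt (\big[Rplus/0]_(i < d) (x i * x i)).

Definition has_grad d (g : vec d -> R) (G : vec d -> vec d) : Prop :=
  forall x eps, 0 < eps -> exists delta, 0 < delta /\
    forall h, vnorm h < delta ->
      Rabs (g (vadd x h) - g x - \big[Rplus/0]_(k < d) (G x k * h k))
        <= eps * vnorm h.

Definition vcont d (g : vec d -> R) : Prop :=
  forall x eps, 0 < eps -> exists delta, 0 < delta /\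
    forall y, vnorm (vsub y x) < delta -> Rabs (g y - g x) < eps.

Definition bounded_fun A (g : A -> R) : Prop := exists K, forall a, Rabs (g a) <= K.

Definition C2_grad_bdd2 d (g : vec d -> R) (G : vec d -> vec d) : Prop :=
  has_grad g G /\
  exists H : vec d -> 'I_d -> 'I_d -> R,
    (forall k, has_grad (fun x => G x k) (fun x => H x k)) /\
    (forall k p, vcont (fun x => H x k p)) /\
    (forall k p, bounded_fun (fun x => H x k p)).

Definition C2b_grad d (g : vec d -> R) (G : vec d -> vec d) : Prop :=
  C2_grad_bdd2 g G /\ (forall k, bounded_fun (fun x => G x k)).

Definition lipschitz d (g : vec d -> R) : Prop :=
  exists K, forall x y, Rabs (g x - g y) <= K * vnorm (vsub x y).

(* dsig j x i p = partial derivative of (sigma_j)_i w.r.t. x_p *)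
Definition milstein_step d m (mu : vec d -> vec d) (sig : 'I_m -> vec d -> vec d)
  (dsig : 'I_m -> vec d -> 'I_d -> 'I_d -> R) (Dt : R) (x : vec d) (xi : 'I_m -> R)
  : vec d :=
  fun i => x i + mu x i * Dt
    + \big[Rplus/0]_(j < m) (sig j x i * xi j)
    + / 2 * \big[Rplus/0]_(j < m) \big[Rplus/0]_(k < m)
        ((\big[Rplus/0]_(p < d) (dsig j x i p * sig k x p))
           * (xi j * xi k - (if j == k then Dt else 0))).

Fixpoint milstein d m mu sig dsig (Dt : R) (X0 : vec d) (incr : nat -> 'I_m -> R)
  (n : nat) : vec d :=
  match n with
  | 0%N => X0
  | n'.+1 => @milstein_step d m mu sig dsig Dt
               (milstein mu sig dsig Dt X0 incr n') (incr n')
  end.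

(* Omega L m: signs of the 2^L * m i.i.d. symmetric +-sqrt(Delta_L) variables,
   with the uniform probability. *)
Definition Omega (L m : nat) := {ffun 'I_(2 ^ L) * 'I_m -> bool}.

Definition Expect (L m : nat) (Y : Omega L m -> R) : R :=
  (\big[Rplus/0]_(w : Omega L m) Y w) / INR #|{: Omega L m}|.

Definition Variance (L m : nat) (Y : Omega L m -> R) : R :=
  Expect (fun w => (Y w - Expect Y) ^ 2).

Definition stepsize (T : R) (l : nat) : R := T / 2 ^ l.

Definition xiL (T : R) (L m : nat) (w : Omega L m) (r : nat) (j : 'I_m) : R :=
  match @insub nat (fun r => r < 2 ^ L)%N _ r with
  | Some o => if w (o, j) then sqrt (stepsize T L) else - sqrt (stepsize T L)
  | None => 0
  end.

Definition xif T L m (l : nat) (w : Omega L m) (i : nat) (j : 'I_m) : R :=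
  \big[Rplus/0]_(i * (2 ^ (L - l))%N <= r < i.+1 * (2 ^ (L - l))%N) xiL T w r j.

Definition xia T L m l (w : Omega L m) (i : nat) (j : 'I_m) : R :=
  xif T l w (if odd i then i.-1 else i.+1) j.

Definition xic T L m l (w : Omega L m) (i : nat) (j : 'I_m) : R :=
  xif T l w (2 * i)%N j + xif T l w (2 * i)%N.+1 j.

Definition Pfine d m mu sig dsig (f : vec d -> R) X0 T L l (w : Omega L m) : R :=
  / 2 * (f (@milstein d m mu sig dsig (stepsize T l) X0 (xif T l w) (2 ^ l)%N)
       + f (@milstein d m mu sig dsig (stepsize T l) X0 (xia T l w) (2 ^ l)%N)).

Definition Pcoarse d m mu sig dsig (f : vec d -> R) X0 T L l (w : Omega L m) : R :=
  f (@milstein d m mu sig dsig (stepsize T l.-1) X0 (xic T l w) (2 ^ l.-1)%N).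

(* Main.v *)
(* With s^2 the fine step, follow the antithetic pair x, y and the coarse path z
   over one coarse step, i.e. two fine increments a, b.  All three quantities
     P = sum_i ((x+y)/2 - z)_i^2,  Q = sum_i (x-z)_i^4 + (y-z)_i^4,
     V = 1 + sum_i x_i^4 + y_i^4 + z_i^4
   are controlled at once: the conditional expectation of W = P + Q + s^4 V grows
   by a factor at most 1 + C s^2.  Two fine steps equal one coarse step plus a
   Levy-area term antisymmetric in (a, b), plus a remainder of size s^3 centered
   given a, plus a drift of size s^4 up to a centered term.  Exchanging a and b
   flips the sign of the Levy term, so averaging x and y leaves only the difference
   of its coefficients at x and y, which Q and V control.
   Initially P = Q = 0 and W = s^4 V, so discrete Gronwall gives E W = O(s^4) at
   the final time, and a Taylor expansion of f at (x+y)/2 bounds the squared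
   correction by a multiple of W.
   The products sigma_j' sigma_k have linear growth and are only locally Lipschitz;
   V absorbs the resulting polynomial weights. *)
From HB Require Import structures.
Require Import Defs.
From Stdlib Require Import Reals Lra Psatz FunctionalExtensionality.
From mathcomp Require Import all_boot.
Set Implicit Arguments. Unset Strict Implicit. Unset Printing Implicit Defensive.
Local Open Scope R_scope.

(** Why these powers: P is a sum of squares, so an error of size s A in (x+y)/2 - z is admissible
    when A^2 is below W. The midpoint expansion leaves |x-z|^2 + |y-z|^2, hence the fourth powers in
    Q. A difference of sigma_j' sigma_k costs N |x-y| with N = 1 + |x| + |y| + |z|; it comes with
    s^2, and s N |x-y| <= |x-y|^2 + (s N)^2, hence the weight s^4 on V. The centered remainder s^3
    N^2 = s (s N)^2 fits too. So the inequality for W closes in itself and no moment bound for the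
    scheme has to be proved beforehand. Why the constant does not see l and L: the step estimate
    uses an increment law only through its mean, its covariance and its normalised eighth moments,
    because the error in W carries eighth powers of the normalised increments. For sums of symmetric
    signs these moments stay below the Gaussian ones, whatever the block length. *)

Lemma RplusA : associative Rplus.
Proof. by move=> x y z; rewrite Rplus_assoc. Qed.
HB.instance Definition _ :=
  Monoid.isComLaw.Build R 0 Rplus RplusA Rplus_comm Rplus_0_l.

Local Notation "\rsum_ ( i < n ) F" := (\big[Rplus/0]_(i < n) F)
  (at level 41, F at level 41, i, n at level 50).

(** * Finite sums *)

Section Sums.
Variables (I : Type) (r : seq I).
Implicit Types F G : I -> R.

Lemma rsumD F G :
  \big[Rplus/0]_(i <- r) (F i + G i)
  = \big[Rplus/0]_(i <- r) F i + \big[Rplus/0]_(i <- r) G i.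
Proof. exact: big_split. Qed.

Lemma rsumZ c F :
  \big[Rplus/0]_(i <- r) (c * F i) = c * \big[Rplus/0]_(i <- r) F i.
Proof.
symmetry; apply: (big_morph (Rmult c)); last by rewrite Rmult_0_r.
by move=> x y; rewrite Rmult_plus_distr_l.
Qed.

Lemma rsumZr c F :
  \big[Rplus/0]_(i <- r) (F i * c) = \big[Rplus/0]_(i <- r) F i * c.
Proof. by rewrite Rmult_comm -rsumZ; apply: eq_bigr => i _; ring. Qed.

Lemma rsumB F G :
  \big[Rplus/0]_(i <- r) (F i - G i)
  = \big[Rplus/0]_(i <- r) F i - \big[Rplus/0]_(i <- r) G i.
Proof.
have -> : \big[Rplus/0]_(i <- r) (F i - G i)
        = \big[Rplus/0]_(i <- r) (F i + (-1) * G i).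
  by apply: eq_bigr => i _; ring.
by rewrite rsumD rsumZ; ring.
Qed.

Lemma rsum_le F G : (forall i, F i <= G i) ->
  \big[Rplus/0]_(i <- r) F i <= \big[Rplus/0]_(i <- r) G i.
Proof.
move=> FG; apply: (big_ind2 Rle) => [|a b c e|i _]; [lra| |exact: FG].
exact: Rplus_le_compat.
Qed.

Lemma rsum_ge0 F : (forall i, 0 <= F i) -> 0 <= \big[Rplus/0]_(i <- r) F i.
Proof. by move=> F0; apply: big_ind => //; [lra|move=> x y; lra]. Qed.

Lemma rsum_abs F :
  Rabs (\big[Rplus/0]_(i <- r) F i) <= \big[Rplus/0]_(i <- r) Rabs (F i).
Proof.
apply: (big_rec2 (fun a b => Rabs a <= b)); first by rewrite Rabs_R0; lra.
by move=> i a b _ ab; have := Rabs_triang (F i) a; lra.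
Qed.
End Sums.

Lemma rsum_ge_term n (F : 'I_n -> R) i :
  (forall j, 0 <= F j) -> F i <= \rsum_(j < n) F j.
Proof.
move=> F0; rewrite (bigD1 i) //=.
have : 0 <= \big[Rplus/0]_(j < n | j != i) F j.
  by apply: big_ind => //; [lra|move=> x y; lra].
by move=> H; rewrite -[X in X <= _]Rplus_0_r; apply: Rplus_le_compat_l.
Qed.

(** The l1 norm replaces [vnorm] in the estimates, since componentwise bounds then add up without
    square roots. It measures increments as well as states. *)
Definition n1 n (x : 'I_n -> R) : R := \rsum_(i < n) Rabs (x i).

Lemma n1_ge0 n (x : 'I_n -> R) : 0 <= n1 x.
Proof. by apply: rsum_ge0 => i; apply: Rabs_pos. Qed.

Lemma n1_ge n (x : 'I_n -> R) i : Rabs (x i) <= n1 x.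
Proof. by apply: (rsum_ge_term (F := fun i => Rabs (x i))) => j; apply: Rabs_pos. Qed.

Lemma n1_triang n (x y z : 'I_n -> R) :
  (forall i, Rabs (x i) <= Rabs (y i) + Rabs (z i)) -> n1 x <= n1 y + n1 z.
Proof. by move=> H; rewrite /n1 -rsumD; apply: rsum_le. Qed.

Lemma vnorm_ge0 n (x : vec n) : 0 <= vnorm x.
Proof. exact: sqrt_pos. Qed.

Lemma vnorm_le_n1 n (x : vec n) : vnorm x <= n1 x.
Proof.
rewrite -(sqrt_Rsqr _ (n1_ge0 x)); apply: sqrt_le_1_alt.
rewrite /Rsqr {1}/n1 -rsumZr; apply: rsum_le => i.
have := n1_ge x i; have := Rabs_pos (x i).
have -> : x i * x i = Rabs (x i) * Rabs (x i) by rewrite -Rabs_mult Rabs_pos_eq //; nra.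
nra.
Qed.

Lemma vnorm_scale n t (v : vec n) : vnorm (fun i => t * v i) = Rabs t * vnorm v.
Proof.
rewrite /vnorm -sqrt_Rsqr_abs -sqrt_mult_alt; last exact: Rle_0_sqr.
by congr sqrt; rewrite -rsumZ; apply: eq_bigr => i _; rewrite /Rsqr; ring.
Qed.

(** * Taylor bounds from gradients *)

Definition lip1 d (g : vec d -> R) := exists K, 0 <= K /\
  forall x y, Rabs (g x - g y) <= K * n1 (vsub x y).

Definition taylor2 d (g : vec d -> R) (G : vec d -> vec d) := exists K, 0 <= K /\
  forall x y, Rabs (g y - g x - \rsum_(k < d) (G x k * (y k - x k)))
    <= K * (n1 (vsub y x) * n1 (vsub y x)).

Lemma derivable_along_line d (g : vec d -> R) G (x v : vec d) t : has_grad g G ->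
  derivable_pt_lim (fun t => g (fun i => x i + t * v i)) t
    (\rsum_(k < d) (G (fun i => (x i + t * v i)) k * v k)).
Proof.
move=> gG eps eps0; have v0 := vnorm_ge0 v.
pose xt : vec d := fun i => x i + t * v i.
(* Dividing by [1 + vnorm v] instead of [vnorm v] covers [v = 0] and makes the final inequality
   strict. *)
have [|del [del0 H]] := gG xt (eps / (2 * (1 + vnorm v))).
  by apply: Rdiv_lt_0_compat; lra.
have del'0 : 0 < del / (1 + vnorm v) by apply: Rdiv_lt_0_compat; lra.
exists (mkposreal _ del'0) => h h0 /= hdel.
have ha := Rabs_pos_lt _ h0.
have hv : Rabs h * (1 + vnorm v) < del.
  move: (Rmult_lt_compat_r (1 + vnorm v) _ _ ltac:(lra) hdel).
  by rewrite /Rdiv Rmult_assoc Rinv_l; lra.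
have := H (fun i => h * v i); rewrite vnorm_scale => /(_ ltac:(nra)).
have -> : vadd xt (fun i => h * v i) = (fun i => x i + (t + h) * v i).
  by apply: functional_extensionality => i; rewrite /vadd /xt; ring.
have -> : \rsum_(k < d) (G xt k * (h * v k)) = h * \rsum_(k < d) (G xt k * v k).
  by rewrite -rsumZ; apply: eq_bigr => i _; ring.
rewrite -/xt; set D := \rsum_(k < d) _; set A := g _ => B.
have -> : (A - g xt) / h - D = (A - g xt - h * D) / h by field.
rewrite /Rdiv Rabs_mult Rabs_inv; apply: (Rmult_lt_reg_r (Rabs h)) => //.
rewrite Rmult_assoc Rinv_l; last lra.
rewrite Rmult_1_r; apply: Rle_lt_trans B _.
have -> : eps / (2 * (1 + vnorm v)) * (Rabs h * vnorm v)
   = eps * Rabs h * (vnorm v / (2 * (1 + vnorm v))) by field; lra.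
have : vnorm v / (2 * (1 + vnorm v)) < 1.
  apply: (Rmult_lt_reg_r (2 * (1 + vnorm v))); first lra.
  by rewrite /Rdiv Rmult_assoc Rinv_l; lra.
have := Rmult_lt_0_compat _ _ eps0 ha; nra.
Qed.

Lemma mean_value d (g : vec d -> R) G (x y : vec d) : has_grad g G ->
  exists c, 0 < c < 1 /\
   g y - g x = \rsum_(k < d) (G (fun i => (x i + c * (y i - x i))) k * (y k - x k)).
Proof.
move=> gG; pose v k := y k - x k.
have [||c [E cc]] := @MVT_cor2 (fun t => g (fun i => x i + t * v i))
  (fun t => \rsum_(k < d) (G (fun i => (x i + t * v i)) k * v k)) 0 1; first lra.
  by move=> c _; apply: derivable_along_line.
exists c; split => //; rewrite Rminus_0_r Rmult_1_r in E; rewrite -E.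
by congr (g _ - g _); apply: functional_extensionality => i; rewrite /v; ring.
Qed.

Lemma bounded_grad_bound d (G : vec d -> vec d) : (forall k, bounded_fun (fun x => G x k)) ->
  exists K, 0 <= K /\ forall x v, Rabs (\rsum_(k < d) (G x k * v k)) <= K * n1 v.
Proof.
move=> bG; suff [K [K0 HK]] : exists K, 0 <= K /\ forall x k, Rabs (G x k) <= K.
  exists K; split => // x v; apply: Rle_trans (rsum_abs _ _) _.
  rewrite -rsumZ; apply: rsum_le => k; rewrite Rabs_mult.
  by apply: Rmult_le_compat_r => //; exact: Rabs_pos.
have /fin_all_exists [K HK] := bG.
exists (n1 K); split => [|x k]; first exact: n1_ge0.
apply: Rle_trans (n1_ge K k); apply: Rle_trans (HK k x) _; exact: Rle_abs.
Qed.

Lemma lip1_bounded_grad d (g : vec d -> R) G : has_grad g G ->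
  (forall k, bounded_fun (fun x => G x k)) -> lip1 g.
Proof.
move=> gG /bounded_grad_bound [K [K0 HK]]; exists K; split => // x y.
by have [c [_ ->]] := mean_value y x gG; apply: HK.
Qed.

(** By the mean value theorem the remainder is the gradient difference between an intermediate point
    and [x], paired with [y - x]; each of the two factors costs one distance. *)
Lemma taylor2_lip_grad d (g : vec d -> R) G : has_grad g G ->
  (forall k, lip1 (fun x => G x k)) -> taylor2 g G.
Proof.
move=> gG /fin_all_exists [K HK].
exists (n1 K); split=> [|x y]; first exact: n1_ge0.
have [c [[c0 c1] ->]] := mean_value x y gG; rewrite -rsumB.
apply: Rle_trans (rsum_abs _ _) _.
rewrite -Rmult_assoc {2}/n1 -rsumZ; apply: rsum_le => k.
rewrite -Rmult_minus_distr_r Rabs_mult.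
apply: Rmult_le_compat_r; first exact: Rabs_pos.
have [Kk0 /(_ (fun i => x i + c * (y i - x i)) x) HKk] := HK k.
apply: Rle_trans HKk _; apply: Rmult_le_compat => //; first exact: n1_ge0.
  by apply: Rle_trans (n1_ge K k); apply: Rle_abs.
apply: rsum_le => i; rewrite /vsub.
have -> : x i + c * (y i - x i) - x i = c * (y i - x i) by ring.
by rewrite Rabs_mult (Rabs_pos_eq c); [have := Rabs_pos (y i - x i); nra|lra].
Qed.

Lemma C2_taylor2 d (g : vec d -> R) G : C2_grad_bdd2 g G ->
  taylor2 g G /\ forall k, lip1 (fun x => G x k).
Proof.
move=> [gG [H [GH [_ bH]]]].
have lG k : lip1 (fun x => G x k) by apply: (lip1_bounded_grad (GH k)) => p; apply: bH.
by split=> //; apply: taylor2_lip_grad.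
Qed.

Lemma lipschitz_lip1 d (g : vec d -> R) : lipschitz g -> lip1 g.
Proof.
move=> [K HK]; exists (Rabs K); split=> [|x y]; first exact: Rabs_pos.
apply: Rle_trans (HK x y) _.
have := Rle_abs K; have := vnorm_le_n1 (vsub x y); have := vnorm_ge0 (vsub x y).
have := Rabs_pos K; nra.
Qed.

(* Taylor at the midpoint of [x] and [y]: the two first-order terms cancel. *)
Lemma midpoint_bound d (g : vec d -> R) G : lip1 g -> taylor2 g G ->
  exists K, 0 <= K /\ forall x y z,
   Rabs (/ 2 * (g x + g y) - g z) <=
     K * (n1 (vsub x y) * n1 (vsub x y)
          + n1 (fun i => / 2 * (x i + y i) - z i)).
Proof.
move=> [K [K0 HK]] [K' [K'0 HK']].
exists (K + K'); split=> [|x y z]; first lra.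
set q := n1 (vsub x y); pose c : vec d := fun i => / 2 * (x i + y i).
have hz := HK c z; rewrite -/(vsub c z) in hz *.
have h1 := HK' c x; have h2 := HK' c y.
have q0 : 0 <= q by apply: n1_ge0.
have xc : n1 (vsub x c) = / 2 * q.
  rewrite /n1 /q -rsumZ; apply: eq_bigr => i _; rewrite /vsub /c.
  have -> : x i - / 2 * (x i + y i) = / 2 * (x i - y i) by field.
  by rewrite Rabs_mult Rabs_pos_eq //; lra.
have yc : n1 (vsub y c) = / 2 * q.
  rewrite /n1 /q -rsumZ; apply: eq_bigr => i _; rewrite /vsub /c.
  have -> : y i - / 2 * (x i + y i) = / 2 * (-(x i - y i)) by field.
  by rewrite Rabs_mult Rabs_Ropp Rabs_pos_eq //; lra.
have E : \rsum_(k < d) (G c k * (y k - c k)) = - \rsum_(k < d) (G c k * (x k - c k)).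
  rewrite -[RHS]Rmult_1_l -Ropp_mult_distr_r Ropp_mult_distr_l -rsumZ.
  by apply: eq_bigr => i _; rewrite /c; field.
rewrite {}E xc in h1 h2; rewrite yc in h2.
move: (\rsum_(k < d) _) h1 h2 => S h1 h2.
have e0 := n1_ge0 (vsub c z); move: (n1 _) hz e0 => e hz e0.
have qq : 0 <= q * q by nra.
have p1 := Rmult_le_pos _ _ K0 e0; have p2 := Rmult_le_pos _ _ K0 qq.
have p3 := Rmult_le_pos _ _ K'0 e0; have p4 := Rmult_le_pos _ _ K'0 qq.
split_Rabs; nra.
Qed.
(** * Averages over finite sample spaces *)

(** On the space of signs this is convertible to [Expect]. *)
Definition avg (W : finType) (F : W -> R) : R :=
  (\big[Rplus/0]_(w : W) F w) / INR #|W|.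

Section Avg.
Variable W : finType.
Implicit Types F G : W -> R.

Lemma eq_avg F G : (forall w, F w = G w) -> avg F = avg G.
Proof. by move=> FG; congr (_ / _); apply: eq_bigr. Qed.

Lemma avgD F G : avg (fun w => F w + G w) = avg F + avg G.
Proof. by rewrite /avg rsumD /Rdiv; ring. Qed.

Lemma avgB F G : avg (fun w => F w - G w) = avg F - avg G.
Proof. by rewrite /avg rsumB /Rdiv; ring. Qed.

Lemma avgZ c F : avg (fun w => c * F w) = c * avg F.
Proof. by rewrite /avg rsumZ /Rdiv; ring. Qed.

Lemma avgZr c F : avg (fun w => F w * c) = avg F * c.
Proof. by rewrite /avg rsumZr /Rdiv; ring. Qed.

Lemma avg_sum (I : finType) (F : I -> W -> R) :
  avg (fun w => \big[Rplus/0]_i F i w) = \big[Rplus/0]_i avg (F i).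
Proof. by rewrite /avg exchange_big /= /Rdiv -rsumZr. Qed.

Hypothesis W0 : (0 < #|W|)%N.

Lemma INR_card_gt0 : 0 < INR #|W|.
Proof. by apply: lt_0_INR; apply/ltP. Qed.

Lemma avg_le F G : (forall w, F w <= G w) -> avg F <= avg G.
Proof.
move=> FG; apply: Rmult_le_compat_r; last exact: rsum_le.
by apply: Rlt_le; apply: Rinv_0_lt_compat; exact: INR_card_gt0.
Qed.

Lemma rsum_cst (c : R) : \big[Rplus/0]_(w : W) c = INR #|W| * c.
Proof.
rewrite big_const; elim: #|W| => [|n IH]; first by rewrite /=; ring.
by rewrite iterS IH S_INR; ring.
Qed.

Lemma avg_cst c : avg (fun _ : W => c) = c.
Proof. by rewrite /avg rsum_cst; have := INR_card_gt0 => *; field; lra. Qed.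

Lemma avg_ge0 F : (forall w, 0 <= F w) -> 0 <= avg F.
Proof. by move=> F0; rewrite -[X in X <= _](avg_cst 0); apply: avg_le. Qed.

Lemma variance_le F :
  avg (fun w => (F w - avg F) ^ 2) <= avg (fun w => F w ^ 2).
Proof.
rewrite (eq_avg (G := fun w => F w ^ 2 - 2 * avg F * F w + avg F * avg F)).
  by rewrite avgD avgB avgZ avg_cst; nra.
by move=> w; ring.
Qed.
End Avg.

Lemma exchange_avg (W1 W2 : finType) (F : W1 -> W2 -> R) :
  avg (fun w => avg (F w)) = avg (fun w' => avg (fun w => F w w')).
Proof. by rewrite /avg /Rdiv !rsumZr exchange_big /=; ring. Qed.

(** * Independence and sign symmetry under the uniform law *)

Section Merge.
Variable J : finType.
Let Om := {ffun J -> bool}.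

Definition merge (S : pred J) (w w' : Om) : Om :=
  [ffun j => if S j then w' j else w j].

Lemma card_signs_gt0 : (0 < #|Om|)%N.
Proof. by apply/card_gt0P; exists [ffun=> true]. Qed.

(* Reindex along the involution [(w, w') |-> (merge w w', merge w' w)]. *)
Lemma avg_merge S (F : Om -> R) :
  avg F = avg (fun w => avg (fun w' => F (merge S w w'))).
Proof.
pose h (p : Om * Om) := (merge S p.1 p.2, merge S p.2 p.1).
have hh : involutive h.
  by move=> [w w']; congr (_, _); apply/ffunP=> j; rewrite !ffunE; case: (S j).
transitivity (avg (fun w => avg (fun _ : Om => F w))).
  by apply: eq_avg => w; rewrite avg_cst //; exact: card_signs_gt0.
rewrite /avg /Rdiv !rsumZr !pair_bigA; congr (_ * _ * _).
exact: (reindex_inj (inv_inj hh)).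
Qed.

(** Independence of the signs outside and inside [S], in Fubini form. Measurability is expressed as
    behaviour under resampling: [U] ignores the signs in [S], and [Z] sees no others. *)
Lemma avg_indep S (A B : Type) (U : Om -> A) (Z : Om -> B) (F : A -> B -> R) :
  (forall w w', U (merge S w w') = U w) ->
  (forall w w', Z (merge S w w') = Z w') ->
  avg (fun w => F (U w) (Z w)) = avg (fun w => avg (fun w' => F (U w) (Z w'))).
Proof.
move=> HU HZ; rewrite (avg_merge S).
by apply: eq_avg => w; apply: eq_avg => w'; rewrite HU HZ.
Qed.

Definition flip (S : pred J) (w : Om) : Om := [ffun j => S j (+) w j].

(** [flip S] is an involution, so it preserves the uniform law. A quantity that it negates therefore
    averages to zero, which yields the means and the mixed second moments of the increments. *)
Lemma avg_flip S (F : Om -> R) : avg F = avg (fun w => F (flip S w)).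
Proof.
have fK : involutive (flip S).
  by move=> w; apply/ffunP=> j; rewrite !ffunE; case: (S j); rewrite //= negbK.
by rewrite /avg; congr (_ * _); exact: (reindex_inj (inv_inj fK)).
Qed.
End Merge.

(** Three rounds of (a+b)^2 <= 2 (a^2 + b^2), with 128 = 2^4 * 2^2 * 2. *)
Lemma pow8_convex u v : (u + v) ^ 8 <= 128 * (u ^ 8 + v ^ 8).
Proof.
have sq a b : (a + b) ^ 2 <= 2 * (a ^ 2 + b ^ 2).
  by have := pow2_ge_0 (a - b); nra.
have h1 := sq u v; have h2 := sq (u ^ 2) (v ^ 2); have h3 := sq (u ^ 4) (v ^ 4).
have p1 : 0 <= (u + v) ^ 2 by apply: pow2_ge_0.
have p2 : ((u + v) ^ 2) ^ 2 <= (2 * (u ^ 2 + v ^ 2)) ^ 2 by apply: pow_incr.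
have p3 : ((u + v) ^ 2) ^ 2 <= 8 * (u ^ 4 + v ^ 4).
  apply: Rle_trans p2 _; move: h2; set A := (u ^ 2 + v ^ 2) ^ 2.
  have -> : (2 * (u ^ 2 + v ^ 2)) ^ 2 = 4 * A by rewrite /A; ring.
  have -> : (u ^ 2) ^ 2 = u ^ 4 by ring.
  have -> : (v ^ 2) ^ 2 = v ^ 4 by ring.
  lra.
have p4 : (((u + v) ^ 2) ^ 2) ^ 2 <= (8 * (u ^ 4 + v ^ 4)) ^ 2.
  by apply: pow_incr; split=> //; apply: pow2_ge_0.
move: h3 p4; set A := (u ^ 4 + v ^ 4) ^ 2.
have -> : (8 * (u ^ 4 + v ^ 4)) ^ 2 = 64 * A by rewrite /A; ring.
have -> : (u ^ 4) ^ 2 = u ^ 8 by ring.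
have -> : (v ^ 4) ^ 2 = v ^ 8 by ring.
have -> : (((u + v) ^ 2) ^ 2) ^ 2 = (u + v) ^ 8 by ring.
lra.
Qed.

(** * Moments of the weak increments *)

(** Size of an increment in units of its standard deviation [s]. The summand 1 makes higher powers
    dominate lower ones. *)
Definition alpha m (s : R) (a : 'I_m -> R) : R := 1 + n1 a / s.

Section Moments.
Variables (T : R) (L m : nat).
Let Om := Omega L m.
Let dL := stepsize T L.
Let sL := sqrt dL.
Hypothesis T0 : 0 < T.

Lemma stepsize_gt0 l : 0 < stepsize T l.
Proof. by apply: Rdiv_lt_0_compat => //; apply: pow_lt; lra. Qed.

Lemma sLsL : sL * sL = dL.
Proof. by apply: sqrt_sqrt; apply: Rlt_le; apply: stepsize_gt0. Qed.

Lemma xiL_pm r j : (r < 2 ^ L)%N ->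
  forall w : Om, xiL T w r j = sL \/ xiL T w r j = - sL.
Proof.
move=> rL w; rewrite /xiL; case: insubP => [o _ _|]; last by rewrite rL.
by case: ifP; [left|right].
Qed.

Lemma xiL_merge S (w w' : Om) r j :
  xiL T (merge S w w') r j =
  if @insub nat (fun r => r < 2 ^ L)%N _ r is Some o then
    (if S (o, j) then xiL T w' r j else xiL T w r j) else 0.
Proof.
by rewrite /xiL; case: insub => // o; rewrite ffunE; case: (S _).
Qed.

Lemma xiL_merge_in (S : pred nat) (w w' : Om) r j : S r ->
  xiL T (merge (fun p : 'I_(2 ^ L) * 'I_m => S p.1) w w') r j = xiL T w' r j.
Proof.
move=> Sr; rewrite xiL_merge; case: insubP => [o _ /= ->|]; first by rewrite Sr.
by move=> ?; rewrite /xiL insubN.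
Qed.

Lemma xiL_merge_out (S : pred nat) (w w' : Om) r j : ~~ S r ->
  xiL T (merge (fun p : 'I_(2 ^ L) * 'I_m => S p.1) w w') r j = xiL T w r j.
Proof.
move=> Sr; rewrite xiL_merge; case: insubP => [o _ /= ->|].
  by rewrite (negbTE Sr).
by move=> ?; rewrite /xiL insubN.
Qed.

Lemma xiL_flip (S : pred ('I_(2 ^ L) * 'I_m)) (w : Om) r j b :
  (forall o, S (o, j) = b) ->
  xiL T (flip S w) r j = if b then - xiL T w r j else xiL T w r j.
Proof.
move=> Sb; rewrite /xiL; case: insub => [o|]; last by case: b {Sb}; ring.
rewrite ffunE Sb; case: b {Sb} => //=.
by case: (w _) => //=; ring.
Qed.

(** The length [n] is free so that moments can be computed by induction on it; [xif_psum] later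
    specialises it to a block. *)
Definition psum (r0 n : nat) (w : Om) j := \big[Rplus/0]_(r0 <= r < r0 + n) xiL T w r j.

Lemma psum_flip (S : pred ('I_(2 ^ L) * 'I_m)) (w : Om) r0 n j b :
  (forall o, S (o, j) = b) ->
  psum r0 n (flip S w) j = if b then - psum r0 n w j else psum r0 n w j.
Proof.
move=> Sb; rewrite /psum; under eq_bigr => r _ do rewrite (xiL_flip _ r Sb).
case: b {Sb} => //.
have -> : - (\big[Rplus/0]_(r0 <= r < r0 + n) xiL T w r j)
   = (-1) * \big[Rplus/0]_(r0 <= r < r0 + n) xiL T w r j by ring.
by rewrite -rsumZ; apply: eq_bigr => r _; ring.
Qed.

Lemma psum_mean r0 n j : avg (fun w => psum r0 n w j) = 0.
Proof.
suff : avg (fun w => psum r0 n w j) = - avg (fun w => psum r0 n w j) by lra.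
rewrite {1}(avg_flip predT).
rewrite -[RHS]Rmult_1_l -Ropp_mult_distr_r Ropp_mult_distr_l -avgZ.
by apply: eq_avg => w; rewrite (@psum_flip predT _ _ _ _ true) //; ring.
Qed.

Lemma psum_cross r0 n j k : j != k -> avg (fun w => psum r0 n w j * psum r0 n w k) = 0.
Proof.
move=> jk; set A := avg _; suff : A = - A by lra.
rewrite {1}/A (avg_flip (fun p : 'I_(2 ^ L) * 'I_m => p.2 == j)).
rewrite -[RHS]Rmult_1_l -Ropp_mult_distr_r Ropp_mult_distr_l -avgZ.
apply: eq_avg => w; rewrite (@psum_flip _ _ _ _ _ true); last by move=> o /=; rewrite eqxx.
rewrite (@psum_flip _ _ _ _ _ false); first ring.
by move=> o /=; apply/negbTE; rewrite eq_sym.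
Qed.

Lemma psumS r0 n w j : psum r0 n.+1 w j = psum r0 n w j + xiL T w (r0 + n) j.
Proof. by rewrite /psum addnS big_nat_recr //= leq_addr. Qed.

(** The new sign is independent of the partial sum, so conditioning on the sum replaces the sign by
    the mean over its two values. *)
Lemma avg_psumS (p : R -> R) r0 n j : (r0 + n < 2 ^ L)%N ->
  avg (fun w => p (psum r0 n.+1 w j)) =
  avg (fun w => / 2 * (p (psum r0 n w j + sL) + p (psum r0 n w j - sL))).
Proof.
move=> rL.
under eq_avg => w do rewrite psumS.
rewrite (avg_indep (S := fun q : 'I_(2 ^ L) * 'I_m => (q.1 == r0 + n :> nat)%N) (U := fun w => psum r0 n w j)
  (Z := fun w => xiL T w (r0 + n) j) (fun u z => p (u + z))).
- apply: eq_avg => w; set u := psum _ _ _ _.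
  rewrite -[RHS](avg_cst (card_signs_gt0 ('I_(2 ^ L) * 'I_m)%type)).
  set A := LHS; set B := RHS; suff : A + A = 2 * B by lra.
  (* Adding the sign-flipped copy brings in both values of the new increment for each [w']. *)
  rewrite {1}/A (avg_flip predT) /A /B -avgD -avgZ; apply: eq_avg => w'.
  rewrite (@xiL_flip predT _ _ _ true) //.
  by case: (xiL_pm j rL w') => ->; rewrite ?Ropp_involutive /Rminus; field.
- move=> w w'; apply: eq_big_nat => r /andP[_ rn].
  by apply: (xiL_merge_out (S := fun q => q == r0 + n)%N); rewrite neq_ltn rn.
- by move=> w w'; apply: (xiL_merge_in (S := fun q => q == r0 + n)%N).
Qed.

(* The constants are the Gaussian moments 1, 3, 15, 105. *)
Lemma psum_moments r0 n j : (r0 + n <= 2 ^ L)%N ->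
  let t := INR n * dL in
  [/\ avg (fun w => psum r0 n w j ^ 2) = t,
      avg (fun w => psum r0 n w j ^ 4) <= 3 * t ^ 2,
      avg (fun w => psum r0 n w j ^ 6) <= 15 * t ^ 3 &
      avg (fun w => psum r0 n w j ^ 8) <= 105 * t ^ 4].
Proof.
have W0 := card_signs_gt0 ('I_(2 ^ L) * 'I_m)%type.
elim: n => [|n IH] rL t; rewrite {}/t.
  have E w : psum r0 0 w j = 0 by rewrite /psum addn0 big_geq.
  have H q : (0 < q)%N -> avg (fun w => psum r0 0 w j ^ q) = 0.
    move=> q0; rewrite -[RHS](avg_cst W0); apply: eq_avg => w.
    by rewrite E pow_i //; apply/ltP.
  by rewrite !H //=; split; lra.
have rL' : (r0 + n < 2 ^ L)%N by rewrite addnS in rL.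
case: (IH (ltnW rL')); rewrite {IH}.
set t := INR n * dL; set S := fun w => psum r0 n w j => E2 E4 E6 E8.
have t0 : 0 <= t.
  by apply: Rmult_le_pos; [exact: pos_INR|apply: Rlt_le; exact: stepsize_gt0].
have d0 : 0 <= dL by apply: Rlt_le; exact: stepsize_gt0.
have Et : INR n.+1 * dL = t + dL by rewrite S_INR /t; ring.
rewrite Et.
have sS : sL ^ 2 = dL by rewrite -sLsL; ring.
have p t2 := Rmult_le_pos _ _ t0 d0.
rewrite (avg_psumS (fun u => u ^ 2)) // (avg_psumS (fun u => u ^ 4)) //.
rewrite (avg_psumS (fun u => u ^ 6)) // (avg_psumS (fun u => u ^ 8)) //.
have tn i k : 0 <= t ^ i * dL ^ k by apply: Rmult_le_pos; apply: pow_le.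
split.
- rewrite (eq_avg (G := fun w => S w ^ 2 + dL)); first by rewrite avgD avg_cst // E2.
  by move=> w; rewrite -/(S w) -sS; field.
(* The average over the two signs keeps the even binomial terms only. Once the lower moments are
   inserted, what is missing to the claimed power of [t + dL] is a sum of nonnegative products
   [tn]. *)
- rewrite (eq_avg (G := fun w => S w ^ 4 + 6 * dL * S w ^ 2 + dL ^ 2)).
    by rewrite !avgD avgZ avg_cst // E2; have := tn 0%N 2%N; move: E4; rewrite /S /=; lra.
  by move=> w; rewrite -/(S w) -sS; field.
- rewrite (eq_avg (G := fun w => S w ^ 6 + 15 * dL * S w ^ 4 + 15 * dL ^ 2 * S w ^ 2 + dL ^ 3)).
    rewrite !avgD !avgZ avg_cst // E2.
    have h : 15 * dL * avg (fun w => S w ^ 4) <= 15 * dL * (3 * t ^ 2).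
      by apply: Rmult_le_compat_l; [lra|exact E4].
    have -> : 15 * (t + dL) ^ 3 = 15 * t ^ 3 + 15 * dL * (3 * t ^ 2)
       + 45 * (t ^ 1 * dL ^ 2) + 15 * (t ^ 0 * dL ^ 3) by ring.
    by have := tn 0%N 3%N; have := tn 1%N 2%N => h1 h2; move: h1 h2 E6 h; rewrite /S /=; lra.
  by move=> w; rewrite -/(S w) -sS; field.
- rewrite (eq_avg (G := fun w => S w ^ 8 + 28 * dL * S w ^ 6 + 70 * dL ^ 2 * S w ^ 4
      + 28 * dL ^ 3 * S w ^ 2 + dL ^ 4)).
    rewrite !avgD !avgZ avg_cst // E2.
    have h : 28 * dL * avg (fun w => S w ^ 6) <= 28 * dL * (15 * t ^ 3).
      by apply: Rmult_le_compat_l; [lra|exact E6].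
    have h' : 70 * dL ^ 2 * avg (fun w => S w ^ 4) <= 70 * dL ^ 2 * (3 * t ^ 2).
      by apply: Rmult_le_compat_l; [nra|exact E4].
    have -> : 105 * (t + dL) ^ 4 = 105 * t ^ 4 + 28 * dL * (15 * t ^ 3)
       + 70 * dL ^ 2 * (3 * t ^ 2) + 420 * (t ^ 2 * dL ^ 2) + 420 * (t ^ 1 * dL ^ 3)
       + 105 * (t ^ 0 * dL ^ 4) by ring.
    have := tn 0%N 4%N; have := tn 1%N 3%N; have := tn 2%N 2%N => h1 h2 h3.
    by move: h1 h2 h3 E8 h h'; rewrite /S /=; lra.
  by move=> w; rewrite -/(S w) -sS; field.
Qed.
End Moments.

(** * Level increments as blocks of finest increments *)

Section Blocks.
Variables (T : R) (L m l : nat).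
Hypotheses (T0 : 0 < T) (lL : (l <= L)%N).
Let Om := Omega L m.
Let K := (2 ^ (L - l))%N.

Definition block (i : nat) : pred nat := fun r => (i * K <= r < i.+1 * K)%N.

Lemma block_end i : (i * K + K = i.+1 * K)%N.
Proof. by rewrite mulSn addnC. Qed.

Lemma xif_merge_in (w w' : Om) i :
  xif T l (merge (fun p : 'I_(2 ^ L) * 'I_m => block i p.1) w w') i = xif T l w' i.
Proof.
apply: functional_extensionality => j; apply: eq_big_nat => r ri.
exact: xiL_merge_in.
Qed.

Lemma xif_merge_out (w w' : Om) i i' : i' != i ->
  xif T l (merge (fun p : 'I_(2 ^ L) * 'I_m => block i p.1) w w') i' = xif T l w i'.
Proof.
move=> ii'; apply: functional_extensionality => j; apply: eq_big_nat => r ri.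
apply: xiL_merge_out; apply: contra ii' => ri'; move: ri ri' => /andP[h1 h2] /andP[h3 h4].
have := leq_ltn_trans h1 h4; have := leq_ltn_trans h3 h2; rewrite !ltn_mul2r !ltnS.
by move=> /andP[_ a] /andP[_ b]; rewrite eqn_leq a b.
Qed.

(** Conditional expectation given the past: [U] is determined by the earlier increments, so the next
    two can be replaced by fresh independent copies. *)
Lemma avg_two_blocks (A : Type) (U : Om -> A) (F : A -> ('I_m -> R) -> ('I_m -> R) -> R) i :
  (forall w w', (forall i', (i' < i)%N -> xif T l w i' = xif T l w' i') -> U w = U w') ->
  avg (fun w : Om => F (U w) (xif T l w i) (xif T l w i.+1)) =
  avg (fun w : Om => avg (fun w' : Om => avg (fun w'' : Om => F (U w) (xif T l w' i) (xif T l w'' i.+1)))).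
Proof.
move=> HU.
have HUm k w w' : (i <= k)%N ->
    U (merge (fun p : 'I_(2 ^ L) * 'I_m => block k p.1) w w') = U w.
  by move=> ik; apply: HU => i' i'i; apply: xif_merge_out; rewrite neq_ltn (leq_trans i'i).
(* Block [i.+1] is split off first, with block [i] counted as part of the past; then block [i] is
   split off from [U]. *)
rewrite (avg_indep (S := fun p : 'I_(2 ^ L) * 'I_m => block i.+1 p.1)
  (U := fun w : Om => (U w, xif T l w i)) (Z := fun w : Om => xif T l w i.+1)
  (fun p z => F p.1 p.2 z)) /=.
- apply: (avg_indep (S := fun p : 'I_(2 ^ L) * 'I_m => block i p.1)
    (fun u a => avg (fun w'' => F u a (@xif T L m l w'' i.+1)))) => w w'.
    exact: HUm.
  exact: xif_merge_in.
- by move=> w w'; rewrite HUm // xif_merge_out // neq_ltn ltnSn.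
- by move=> w w'; rewrite xif_merge_in.
Qed.

Lemma xif_psum (w : Om) i j : xif T l w i j = psum T (i * K) K w j.
Proof. by rewrite /xif /psum block_end. Qed.

Lemma block_in_range i : (i < 2 ^ l)%N -> (i * K + K <= 2 ^ L)%N.
Proof.
by move=> il; rewrite block_end -(subnKC lL) expnD leq_mul2r il orbT.
Qed.

Lemma INR_expn2 n : INR (2 ^ n)%N = 2 ^ n.
Proof. by elim: n => [//|n IH]; rewrite expnS mult_INR IH. Qed.

Lemma stepsize_block : INR K * stepsize T L = stepsize T l.
Proof.
rewrite INR_expn2 /stepsize -{2}(subnKC lL) pow_add.
by field; split; apply: pow_nonzero; lra.
Qed.
End Blocks.

(** All that the one-step analysis uses about an increment law: the first two moments of a Wiener
    increment over time [s * s], and a scale-free bound on tails. *)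
Definition good_increment (W : finType) m (s : R) (X : W -> 'I_m -> R) (G : R) : Prop :=
  [/\ (forall j, avg (fun w => X w j) = 0),
      (forall j k, avg (fun w => X w j * X w k - (if j == k then s * s else 0)) = 0) &
      avg (fun w => alpha s (X w) ^ 8) <= G].

Lemma alpha8_bound m : exists G, forall (W : finType) (s : R) (X : W -> 'I_m -> R),
  (0 < #|W|)%N -> 0 < s ->
  (forall j, avg (fun w => X w j ^ 8) <= 105 * s ^ 8) ->
  avg (fun w => alpha s (X w) ^ 8) <= G.
Proof.
have [C HC] : exists C, forall (W : finType) (s : R) (X : W -> 'I_m -> R),
  (0 < #|W|)%N -> 0 < s ->
  (forall j, avg (fun w => X w j ^ 8) <= 105 * s ^ 8) ->
  avg (fun w => (\big[Rplus/0]_(j < m) (Rabs (X w j) / s)) ^ 8) <= C.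
  (* Induction on the list of components: each one contributes its moment 105 and one use of
     [pow8_convex]. *)
  elim: (index_enum _) => [|j r [C HC]].
    exists 0 => W s X W0 _ _; rewrite -[X in _ <= X](avg_cst W0); apply: avg_le => // w.
    by rewrite big_nil; lra.
  exists (128 * (105 + C)) => W s X W0 s0 HX.
  apply: (@Rle_trans _ (avg (fun w => 128 * ((Rabs (X w j) / s) ^ 8
     + (\big[Rplus/0]_(j <- r) (Rabs (X w j) / s)) ^ 8))) _ _).
    by apply: avg_le => // w; rewrite big_cons; apply: pow8_convex.
  rewrite avgZ avgD; apply: Rmult_le_compat_l; first lra.
  apply: Rplus_le_compat; last exact: HC.
  have s8 : 0 < s ^ 8 by apply: pow_lt.
  rewrite (eq_avg (G := fun w => X w j ^ 8 * / s ^ 8)); last first.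
    move=> w; rewrite Rpow_mult_distr pow_inv RPow_abs Rabs_pos_eq //.
    by have -> : X w j ^ 8 = (X w j ^ 4) ^ 2 by [ring]; apply: pow2_ge_0.
  rewrite avgZr; apply: (Rmult_le_reg_r (s ^ 8)) => //.
  by rewrite Rmult_assoc Rinv_l; [rewrite Rmult_1_r; apply: HX|lra].
exists (128 * (1 + C)) => W s X W0 s0 HX.
apply: (@Rle_trans _ (avg (fun w => 128 * (1 ^ 8
     + (\big[Rplus/0]_(j < m) (Rabs (X w j) / s)) ^ 8))) _ _).
  apply: avg_le => // w; rewrite /alpha /n1 /Rdiv -rsumZr; exact: pow8_convex.
rewrite avgZ avgD; apply: Rmult_le_compat_l; first lra.
apply: Rplus_le_compat; last exact: HC.
by rewrite avg_cst // pow1; lra.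
Qed.

(** [G] is chosen before [T], [L] and [l]; the uniformity of the final constant in the finest level
    comes from here. *)
Lemma xif_good m : exists G, forall T L l i, 0 < T -> (l <= L)%N -> (i < 2 ^ l)%N ->
  good_increment (sqrt (stepsize T l)) (fun w : Omega L m => xif T l w i) G.
Proof.
have [G HG] := alpha8_bound m; exists G => T L l i T0 lL il.
have W0 := card_signs_gt0 ('I_(2 ^ L) * 'I_m)%type.
have d0 := stepsize_gt0 T0 l.
have ss : sqrt (stepsize T l) * sqrt (stepsize T l) = stepsize T l.
  by apply: sqrt_sqrt; lra.
have Hm j := psum_moments (m := m) T0 j (block_in_range lL il).
split=> [j|j k|].
- under eq_avg => w do rewrite xif_psum.
  exact: psum_mean.
- under eq_avg => w do rewrite !xif_psum.
  rewrite avgB avg_cst // ss; case: eqP => [<-|/eqP jk]; last by rewrite psum_cross //; ring.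
  have [E _ _ _] := Hm j; rewrite stepsize_block // in E; rewrite -E.
  by apply: Rminus_diag_eq; apply: eq_avg => w; ring.
- apply: HG => // [|j]; first exact: sqrt_lt_R0.
  under eq_avg => w do rewrite xif_psum.
  have [_ _ _ E] := Hm j; rewrite stepsize_block // in E.
  have -> // : sqrt (stepsize T l) ^ 8 = stepsize T l ^ 4 by rewrite -[in RHS]ss; ring.
Qed.

(** * Conditional expectation over one coarse step *)

Section OneStep.
Variables (W : finType) (m : nat) (s G : R) (X Y : W -> 'I_m -> R).
Hypotheses (W0 : (0 < #|W|)%N) (GX : good_increment s X G) (GY : good_increment s Y G).
Implicit Types F : ('I_m -> R) -> ('I_m -> R) -> R.

(** Expectation over two independent increments with the state frozen. The laws are explicit
    arguments so that they can be exchanged, as the antithetic path requires. *)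
Definition EE (X Y : W -> 'I_m -> R) F := avg (fun w => avg (fun w' => F (X w) (Y w'))).

Lemma eq_EE F F' : (forall a b, F a b = F' a b) -> EE X Y F = EE X Y F'.
Proof. by move=> FF; apply: eq_avg => w; apply: eq_avg => w'. Qed.

Lemma EED F F' : EE X Y (fun a b => F a b + F' a b) = EE X Y F + EE X Y F'.
Proof. by rewrite /EE -avgD; apply: eq_avg => w; rewrite avgD. Qed.

Lemma EEZ c F : EE X Y (fun a b => c * F a b) = c * EE X Y F.
Proof. by rewrite /EE -avgZ; apply: eq_avg => w; rewrite avgZ. Qed.

Lemma EE_le F F' : (forall a b, F a b <= F' a b) -> EE X Y F <= EE X Y F'.
Proof. by move=> FF; apply: avg_le => // w; apply: avg_le. Qed.

Lemma EE_cst c : EE X Y (fun _ _ => c) = c.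
Proof. by rewrite /EE !avg_cst. Qed.

Lemma EE_sum (I : finType) (F : I -> ('I_m -> R) -> ('I_m -> R) -> R) :
  EE X Y (fun a b => \big[Rplus/0]_i F i a b) = \big[Rplus/0]_i EE X Y (F i).
Proof. by rewrite /EE -avg_sum; apply: eq_avg => w; rewrite avg_sum. Qed.

Definition centered F := EE X Y F = 0.

Lemma eq_centered F F' : (forall a b, F a b = F' a b) -> centered F' -> centered F.
Proof. by rewrite /centered => /eq_EE ->. Qed.

Lemma centeredD F F' : centered F -> centered F' -> centered (fun a b => F a b + F' a b).
Proof. by rewrite /centered EED => -> ->; ring. Qed.

Lemma centeredZ c F : centered F -> centered (fun a b => c * F a b).
Proof. by rewrite /centered EEZ => ->; ring. Qed.

Lemma centered_sum (I : finType) (F : I -> ('I_m -> R) -> ('I_m -> R) -> R) :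
  (forall i, centered (F i)) -> centered (fun a b => \big[Rplus/0]_i F i a b).
Proof. by move=> HF; rewrite /centered EE_sum; apply: big1 => i _; apply: HF. Qed.

(** Martingale difference property: [b] has mean zero given [a], so the coefficient may depend on
    [a], for instance through the state after the first fine step. *)
Lemma centered_b (H : ('I_m -> R) -> R) j : centered (fun a b => H a * b j).
Proof.
have [M _ _] := GY; rewrite /centered -[RHS](avg_cst W0 0); apply: eq_avg => w.
by rewrite avgZ M; ring.
Qed.

Lemma centered_bb (H : ('I_m -> R) -> R) j k :
  centered (fun a b => H a * (b j * b k - (if j == k then s * s else 0))).
Proof.
have [_ M _] := GY; rewrite /centered -[RHS](avg_cst W0 0); apply: eq_avg => w.
by rewrite avgZ M; ring.
Qed.

Lemma EE_alpha8 : EE X Y (fun a b => alpha s a ^ 8 * alpha s b ^ 8) <= G * G.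
Proof.
have [_ _ A] := GX; have [_ _ B] := GY.
rewrite /EE (eq_avg (G := fun w => alpha s (X w) ^ 8 * avg (fun w' => alpha s (Y w') ^ 8))).
  have p8 (a : 'I_m -> R) : 0 <= alpha s a ^ 8.
    by have -> : alpha s a ^ 8 = (alpha s a ^ 4) ^ 2 by [ring]; apply: pow2_ge_0.
  by rewrite avgZr; apply: Rmult_le_compat => //; apply: avg_ge0 => // w.
by move=> w; rewrite avgZ.
Qed.
End OneStep.

Lemma EE_swap (W : finType) m (X Y : W -> 'I_m -> R) F :
  EE X Y F = EE Y X (fun a b => F b a).
Proof. exact: exchange_avg. Qed.

Lemma centered_swap (W : finType) m (X Y : W -> 'I_m -> R) F :
  centered Y X F -> centered X Y (fun a b => F b a).
Proof. by rewrite /centered EE_swap. Qed.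

(** * Order-of-magnitude calculus *)

(** Big-O with a constant uniform over [I]. Later [I] bundles step, paths and increments, so
    uniformity in all of them is automatic. *)
Definition dom (I : Type) (f g : I -> R) := exists C, 0 <= C /\ forall p, Rabs (f p) <= C * g p.

Section Dom.
Variable I : Type.
Implicit Types f g h : I -> R.

Lemma dom_le f g : (forall p, Rabs (f p) <= g p) -> dom f g.
Proof. by move=> H; exists 1; split=> [|p]; [lra|have := H p; lra]. Qed.

Lemma eq_dom f f' g : (forall p, f p = f' p) -> dom f' g -> dom f g.
Proof. by move=> E [C [C0 H]]; exists C; split=> // p; rewrite E. Qed.

Lemma dom_trans f g h : dom f g -> dom g h -> dom f h.
Proof.
move=> [C [C0 H]] [C' [C0' H']]; exists (C * C'); split=> [|p].
  exact: Rmult_le_pos.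
apply: Rle_trans (H p) _; rewrite Rmult_assoc; apply: Rmult_le_compat_l => //.
by apply: Rle_trans (H' p); apply: Rle_abs.
Qed.

Lemma domD f f' g : dom f g -> dom f' g -> dom (fun p => f p + f' p) g.
Proof.
move=> [C [C0 H]] [C' [C0' H']]; exists (C + C'); split=> [|p]; first lra.
by have := Rabs_triang (f p) (f' p); have := H p; have := H' p; lra.
Qed.

Lemma domM f f' g g' : dom f g -> dom f' g' -> dom (fun p => f p * f' p) (fun p => g p * g' p).
Proof.
move=> [C [C0 H]] [C' [C0' H']]; exists (C * C'); split=> [|p].
  exact: Rmult_le_pos.
have -> : C * C' * (g p * g' p) = C * g p * (C' * g' p) by ring.
by rewrite Rabs_mult; apply: Rmult_le_compat => //; apply: Rabs_pos.
Qed.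

Lemma domZ c f g : dom f g -> dom (fun p => c * f p) g.
Proof.
move=> [C [C0 H]]; exists (Rabs c * C); split=> [|p].
  by apply: Rmult_le_pos => //; apply: Rabs_pos.
by rewrite Rabs_mult Rmult_assoc; apply: Rmult_le_compat_l => //; apply: Rabs_pos.
Qed.

Lemma domB f f' g : dom f g -> dom f' g -> dom (fun p => f p - f' p) g.
Proof.
by move=> H /(domZ (-1)) H'; apply: eq_dom (domD H H') => p; ring.
Qed.

Lemma dom_abs f g : dom f g -> dom (fun p => Rabs (f p)) g.
Proof. by move=> [C [C0 H]]; exists C; split=> // p; rewrite Rabs_Rabsolu. Qed.

Lemma dom_sum n (F : 'I_n -> I -> R) g : (forall p, 0 <= g p) -> (forall i, dom (F i) g) ->
  dom (fun p => \rsum_(i < n) F i p) g.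
Proof.
move=> g0 HF; elim: (index_enum _) => [|i r IH].
  by apply: dom_le => p; rewrite big_nil Rabs_R0.
by apply: eq_dom (domD (HF i) IH) => p; rewrite big_cons.
Qed.

Lemma dom_n1 n (u : I -> 'I_n -> R) g : (forall p, 0 <= g p) ->
  (forall i, dom (fun p => u p i) g) -> dom (fun p => n1 (u p)) g.
Proof. by move=> g0 H; apply: dom_sum => // i; apply: dom_abs. Qed.

Lemma dom_wider f g g' : (forall p, g p <= g' p) -> dom f g -> dom f g'.
Proof.
move=> gg [C [C0 H]]; exists C; split=> // p; apply: Rle_trans (H p) _.
exact: Rmult_le_compat_l.
Qed.
End Dom.

(** * The Milstein step *)

Section Trajectory.
Variables (d m : nat) (mu : vec d -> vec d) (sig : 'I_m -> vec d -> vec d).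
Variables (dsig : 'I_m -> vec d -> 'I_d -> 'I_d -> R) (gmu : 'I_d -> vec d -> vec d).

(* [hmil j k i] is the i-th component of sigma_j' sigma_k. *)
Definition hmil (j k : 'I_m) (i : 'I_d) (x : vec d) :=
  \rsum_(p < d) (dsig j x i p * sig k x p).

Definition qvar (D : R) (a : 'I_m -> R) (j k : 'I_m) := a j * a k - (if j == k then D else 0).

Definition mart D x a i := \rsum_(j < m) (sig j x i * a j)
  + / 2 * \rsum_(j < m) \rsum_(k < m) (hmil j k i x * qvar D a j k).

(** Discrete Levy area against sigma_j' sigma_k at [x]; exchanging [a] and [b] changes its sign. *)
Definition levy x (a b : 'I_m -> R) i :=
  / 2 * \rsum_(j < m) \rsum_(k < m) (hmil j k i x * (a k * b j - a j * b k)).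

(** Error of freezing the coefficients of the second fine step at [x], beyond the first-order
    correction of sigma_j by sigma_j' sigma_k a_k. Each term is a coefficient known from [x] and
    [x1] times a centered expression in [b]. *)
Definition rem D x x1 (a b : 'I_m -> R) i :=
  \rsum_(j < m) ((sig j x1 i - sig j x i - \rsum_(k < m) (hmil j k i x * a k)) * b j)
  + / 2 * \rsum_(j < m) \rsum_(k < m) ((hmil j k i x1 - hmil j k i x) * qvar D b j k).

Let step := milstein_step mu sig dsig.

Lemma stepE D x a i : step D x a i = x i + mu x i * D + mart D x a i.
Proof. by rewrite /step /milstein_step /mart /hmil /qvar; ring. Qed.

Lemma rsum2D (F F' : 'I_m -> 'I_m -> R) :
  \rsum_(j < m) \rsum_(k < m) (F j k + F' j k) =
  \rsum_(j < m) \rsum_(k < m) F j k + \rsum_(j < m) \rsum_(k < m) F' j k.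
Proof. by rewrite -rsumD; apply: eq_bigr => j _; rewrite rsumD. Qed.

Lemma rsum2B (F F' : 'I_m -> 'I_m -> R) :
  \rsum_(j < m) \rsum_(k < m) (F j k - F' j k) =
  \rsum_(j < m) \rsum_(k < m) F j k - \rsum_(j < m) \rsum_(k < m) F' j k.
Proof. by rewrite -rsumB; apply: eq_bigr => j _; rewrite rsumB. Qed.

(** The correction sigma_j' sigma_k a_k b_j of the second step splits into a symmetric half, which
    completes the products of [a + b] in the coarse step, and an antisymmetric half, which is
    [levy]. *)
Lemma two_steps D x a b i :
  step D (step D x a) b i =
  x i + 2 * D * mu x i + mart (2 * D) x (fun j => a j + b j) i
  + levy x a b i + rem D x (step D x a) a b i + D * (mu (step D x a) i - mu x i).
Proof.
rewrite [LHS]stepE; move Ex1 : (step D x a) => x1.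
have -> : x1 i = x i + mu x i * D + mart D x a i by rewrite -Ex1 stepE.
have Es : \rsum_(j < m) ((sig j x1 i - sig j x i - \rsum_(k < m) (hmil j k i x * a k)) * b j)
  = \rsum_(j < m) (sig j x1 i * b j) - \rsum_(j < m) (sig j x i * b j)
    - \rsum_(j < m) \rsum_(k < m) (hmil j k i x * a k * b j).
  rewrite -!rsumB; apply: eq_bigr => j _.
  have -> : \rsum_(k < m) (hmil j k i x * a k * b j)
    = (\rsum_(k < m) (hmil j k i x * a k)) * b j by exact: rsumZr.
  by ring.
have Eh : \rsum_(j < m) \rsum_(k < m) ((hmil j k i x1 - hmil j k i x) * qvar D b j k)
  = \rsum_(j < m) \rsum_(k < m) (hmil j k i x1 * qvar D b j k)
    - \rsum_(j < m) \rsum_(k < m) (hmil j k i x * qvar D b j k).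
  by rewrite -rsum2B; apply: eq_bigr => j _; apply: eq_bigr => k _; ring.
have El : \rsum_(j < m) \rsum_(k < m) (hmil j k i x * (a k * b j - a j * b k))
  = \rsum_(j < m) \rsum_(k < m) (hmil j k i x * a k * b j)
    - \rsum_(j < m) \rsum_(k < m) (hmil j k i x * a j * b k).
  by rewrite -rsum2B; apply: eq_bigr => j _; apply: eq_bigr => k _; ring.
have Ec : \rsum_(j < m) \rsum_(k < m) (hmil j k i x * qvar (2 * D) (fun j => a j + b j) j k)
  = \rsum_(j < m) \rsum_(k < m) (hmil j k i x * qvar D a j k)
    + \rsum_(j < m) \rsum_(k < m) (hmil j k i x * qvar D b j k)
    + \rsum_(j < m) \rsum_(k < m) (hmil j k i x * a k * b j)
    + \rsum_(j < m) \rsum_(k < m) (hmil j k i x * a j * b k).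
  rewrite -!rsum2D; apply: eq_bigr => j _; apply: eq_bigr => k _.
  by rewrite /qvar; case: ifP => _; ring.
have Ev : \rsum_(j < m) (sig j x i * (a j + b j))
  = \rsum_(j < m) (sig j x i * a j) + \rsum_(j < m) (sig j x i * b j).
  by rewrite -rsumD; apply: eq_bigr => j _; ring.
by rewrite /rem /mart /levy Es Eh El Ec Ev; field.
Qed.

Hypothesis lip_mu : forall i, lip1 (fun x => mu x i).
Hypothesis tay_mu : forall i, taylor2 (fun x => mu x i) (gmu i).
Hypothesis bnd_gmu : forall i k, bounded_fun (fun x => gmu i x k).
Hypothesis lip_sig : forall j i, lip1 (fun x => sig j x i).
Hypothesis tay_sig : forall j i, taylor2 (fun x => sig j x i) (fun x => dsig j x i).
Hypothesis lip_dsig : forall j i p, lip1 (fun x => dsig j x i p).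
Hypothesis bnd_dsig : forall j i p, bounded_fun (fun x => dsig j x i p).

Section OneTrajectory.
Variables (I : Type) (S : R) (s N : I -> R) (x : I -> vec d) (a b : I -> 'I_m -> R).
Hypothesis s0 : forall p, 0 < s p.
Hypothesis sS : forall p, s p <= S.
Hypothesis xN : forall p, 1 + n1 (x p) <= N p.

(* All sizes are measured by monomials in the root [s] of the step, the growth weight [N]
   and the normalised increments; small powers of [s] dominate large ones since [s <= S]. *)
Definition mono i n k l (p : I) :=
  s p ^ i * N p ^ n * alpha (s p) (a p) ^ k * alpha (s p) (b p) ^ l.

Lemma alpha_ge1 t n (v : 'I_n -> R) : 0 < t -> 1 <= alpha t v.
Proof.
move=> t0; rewrite /alpha; have := n1_ge0 v => v0.
suff : 0 <= n1 v / t by lra.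
by apply: Rmult_le_pos => //; apply: Rlt_le; apply: Rinv_0_lt_compat.
Qed.

Lemma N_ge1 p : 1 <= N p.
Proof. by have := xN p; have := n1_ge0 (x p); lra. Qed.

Lemma mono_ge0 i n k l p : 0 <= mono i n k l p.
Proof.
have := s0 p; have := N_ge1 p; have := alpha_ge1 (a p) (s0 p); have := alpha_ge1 (b p) (s0 p).
by move=> ? ? ? ?; repeat apply: Rmult_le_pos; apply: pow_le; lra.
Qed.

Lemma mono_weaken i n k l i' n' k' l' :
  (i' <= i)%N -> (n <= n')%N -> (k <= k')%N -> (l <= l')%N ->
  dom (mono i n k l) (mono i' n' k' l').
Proof.
move=> /subnKC <- nn kk ll; exists ((1 + Rabs S) ^ (i - i')); split=> [|p].
  by apply: pow_le; have := Rabs_pos S; lra.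
rewrite Rabs_pos_eq; last exact: mono_ge0.
have sp := s0 p; have Np := N_ge1 p; have ap := alpha_ge1 (a p) sp.
have bp := alpha_ge1 (b p) sp; rewrite /mono pow_add.
have -> : s p ^ i' * s p ^ (i - i') * N p ^ n * alpha (s p) (a p) ^ k * alpha (s p) (b p) ^ l
  = s p ^ i' * (s p ^ (i - i') * N p ^ n * alpha (s p) (a p) ^ k * alpha (s p) (b p) ^ l) by ring.
have -> : (1 + Rabs S) ^ (i - i') * (s p ^ i' * N p ^ n' * alpha (s p) (a p) ^ k'
    * alpha (s p) (b p) ^ l') =
  s p ^ i' * ((1 + Rabs S) ^ (i - i') * N p ^ n' * alpha (s p) (a p) ^ k'
    * alpha (s p) (b p) ^ l') by ring.
have pw t q q' : 1 <= t -> (q <= q')%N -> t ^ q <= t ^ q'.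
  by move=> t1 /leP; apply: Rle_pow.
have := sS p; have := Rle_abs S => hS hS'.
have pos t q : 0 <= t -> 0 <= t ^ q by exact: pow_le.
apply: Rmult_le_compat_l; first by apply: pos; lra.
do 3! (apply: Rmult_le_compat; [by repeat (apply: Rmult_le_pos || apply: pos); lra
  |by apply: pos; lra| |by apply: pw]).
by apply: pow_incr; lra.
Qed.

Lemma dom_mono f i n k l i' n' k' l' :
  dom f (mono i n k l) ->
  (i' <= i)%N && (n <= n')%N && (k <= k')%N && (l <= l')%N -> dom f (mono i' n' k' l').
Proof.
move=> H /andP[/andP[/andP[? ?] ?] ?]; apply: dom_trans H _; exact: mono_weaken.
Qed.

Lemma domMm f f' i n k l i' n' k' l' :
  dom f (mono i n k l) -> dom f' (mono i' n' k' l') ->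
  dom (fun p => f p * f' p) (mono (i + i') (n + n') (k + k') (l + l')).
Proof.
move=> H H'; apply: dom_wider (domM H H') => p; rewrite /mono !pow_add; lra.
Qed.

Lemma dom_s2 : dom (fun p => s p * s p) (mono 2 0 0 0).
Proof.
by apply: dom_le => p; rewrite Rabs_pos_eq /mono /=; have := s0 p; nra.
Qed.

Lemma le_alpha t n (v : 'I_n -> R) j : 0 < t -> Rabs (v j) <= t * alpha t v.
Proof.
move=> t0; have := n1_ge v j; rewrite /alpha => ?.
have -> : t * (1 + n1 v / t) = t + n1 v by field; lra.
lra.
Qed.

Lemma dom_a j : dom (fun p => a p j) (mono 1 0 1 0).
Proof. by apply: dom_le => p; have := le_alpha (a p) j (s0 p); rewrite /mono /=; lra. Qed.

Lemma dom_b j : dom (fun p => b p j) (mono 1 0 0 1).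
Proof. by apply: dom_le => p; have := le_alpha (b p) j (s0 p); rewrite /mono /=; lra. Qed.

Lemma dom_delta c (j k : 'I_m) : dom (fun p => if j == k then c * (s p * s p) else 0) (mono 2 0 0 0).
Proof.
case: (j == k); first by apply: domZ; apply: dom_s2.
by apply: dom_le => p; rewrite Rabs_R0; apply: mono_ge0.
Qed.

Lemma dom_qvar_b j k : dom (fun p => qvar (s p * s p) (b p) j k) (mono 2 0 0 2).
Proof.
apply: domB; first exact: dom_mono (domMm (dom_b j) (dom_b k)) _.
by apply: dom_mono (_ : dom _ (mono 2 0 0 0)) _ => //; apply: eq_dom (dom_delta 1 j k) => p; case: ifP => _; ring.
Qed.

Lemma dom_qvar_a j k : dom (fun p => qvar (s p * s p) (a p) j k) (mono 2 0 2 0).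
Proof.
apply: domB; first exact: dom_mono (domMm (dom_a j) (dom_a k)) _.
by apply: dom_mono (_ : dom _ (mono 2 0 0 0)) _ => //; apply: eq_dom (dom_delta 1 j k) => p; case: ifP => _; ring.
Qed.

Lemma dom_ab j : dom (fun p => a p j + b p j) (mono 1 0 1 1).
Proof.
by apply: domD; [apply: dom_mono (dom_a j) _|apply: dom_mono (dom_b j) _].
Qed.

Lemma dom_qvar_ab j k :
  dom (fun p => qvar (2 * (s p * s p)) (fun j => a p j + b p j) j k) (mono 2 0 2 2).
Proof.
apply: domB; first exact: dom_mono (domMm (dom_ab j) (dom_ab k)) _.
exact: dom_mono (dom_delta 2 j k) _.
Qed.

Lemma dom_levy_area j k : dom (fun p => a p k * b p j - a p j * b p k) (mono 2 0 1 1).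
Proof. by apply: domB; [apply: (domMm (dom_a k) (dom_b j))|apply: (domMm (dom_a j) (dom_b k))]. Qed.

Lemma dom_lip1 g (u v : I -> vec d) : lip1 g ->
  dom (fun p => g (u p) - g (v p)) (fun p => n1 (vsub (u p) (v p))).
Proof. by move=> [K [K0 HK]]; exists K. Qed.

Lemma dom_growth g : lip1 g -> dom (fun p => g (x p)) (mono 0 1 0 0).
Proof.
move=> [K [K0 HK]]; exists (Rabs (g (fun _ => 0)) + K); split=> [|p].
  by have := Rabs_pos (g (fun _ => 0)); lra.
have := HK (x p) (fun _ => 0).
have -> : n1 (vsub (x p) (fun _ => 0)) = n1 (x p).
  by apply: eq_bigr => i _; rewrite /vsub Rminus_0_r.
have := xN p; have := Rabs_pos (g (fun _ => 0)); have := n1_ge0 (x p).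
rewrite /mono /=; set G := g (fun _ => 0) => ? ? ? ?.
have : Rabs (g (x p)) <= Rabs (g (x p) - G) + Rabs G by split_Rabs; lra.
by nra.
Qed.

Lemma dom_bounded g (u : I -> vec d) : bounded_fun g -> dom (fun p => g (u p)) (mono 0 0 0 0).
Proof.
move=> [K HK]; exists (Rabs K); split=> [|p]; first exact: Rabs_pos.
by rewrite /mono /=; have := HK (u p); have := Rle_abs K; lra.
Qed.

Lemma dom_h j k i : dom (fun p => hmil j k i (x p)) (mono 0 1 0 0).
Proof.
apply: dom_sum => [p|q]; first exact: mono_ge0.
exact: (domMm (dom_bounded x (bnd_dsig j i q)) (dom_growth (lip_sig k q))).
Qed.

(** Leibniz split of the product. The Lipschitz difference of [dsig] is multiplied by [sig], which
    grows linearly; this costs the factor [N]. *)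
Lemma dom_dh j k i (u : I -> vec d) :
  dom (fun p => hmil j k i (u p) - hmil j k i (x p))
      (fun p => N p * n1 (vsub (u p) (x p))).
Proof.
have g0 p : 0 <= N p * n1 (vsub (u p) (x p)).
  by apply: Rmult_le_pos; [have := N_ge1 p; lra|exact: n1_ge0].
apply: (eq_dom (f' := fun p => \rsum_(q < d)
   (dsig j (u p) i q * (sig k (u p) q - sig k (x p) q)
    + sig k (x p) q * (dsig j (u p) i q - dsig j (x p) i q)))).
  by move=> p; rewrite /hmil -rsumB; apply: eq_bigr => q _; ring.
apply: dom_sum => // q; apply: domD.
  apply: dom_wider (domM (dom_bounded u (bnd_dsig j i q)) (dom_lip1 u x (lip_sig k q))) => p.
  apply: Rmult_le_compat_r; first exact: n1_ge0.
  by rewrite /mono /=; have := N_ge1 p; lra.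
apply: dom_wider (domM (dom_growth (lip_sig k q)) (dom_lip1 u x (lip_dsig j i q))) => p.
by apply: Rmult_le_compat_r; [exact: n1_ge0|rewrite /mono /=; lra].
Qed.

Definition half p := step (s p * s p) (x p) (a p).

(** Once the leading noise is removed, only the drift and the quadratic noise remain, both of order
    s^2. *)
Lemma dom_half_noise i :
  dom (fun p => half p i - x p i - \rsum_(k < m) (sig k (x p) i * a p k)) (mono 2 1 2 0).
Proof.
apply: (eq_dom (f' := fun p => mu (x p) i * (s p * s p)
  + / 2 * \rsum_(j < m) \rsum_(k < m) (hmil j k i (x p) * qvar (s p * s p) (a p) j k))).
  by move=> p; rewrite /half stepE /mart; ring.
apply: domD; first exact: dom_mono (domMm (dom_growth (lip_mu i)) dom_s2) _.
apply: domZ; apply: dom_sum => [p|j]; first exact: mono_ge0.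
apply: dom_sum => [p|k]; first exact: mono_ge0.
exact: dom_mono (domMm (dom_h j k i) (dom_qvar_a j k)) _.
Qed.

Lemma dom_half i : dom (fun p => half p i - x p i) (mono 1 1 2 0).
Proof.
apply: (eq_dom (f' := fun p => (half p i - x p i - \rsum_(k < m) (sig k (x p) i * a p k))
   + \rsum_(k < m) (sig k (x p) i * a p k))); first by move=> p; ring.
apply: domD; first exact: dom_mono (dom_half_noise i) _.
apply: dom_sum => [p|k]; first exact: mono_ge0.
exact: dom_mono (domMm (dom_growth (lip_sig k i)) (dom_a k)) _.
Qed.

Lemma dom_half_n1 : dom (fun p => n1 (vsub (half p) (x p))) (mono 1 1 2 0).
Proof. by apply: dom_n1 => [p|i]; [exact: mono_ge0|exact: dom_half]. Qed.

Lemma dom_half_lip1 g : lip1 g -> dom (fun p => g (half p) - g (x p)) (mono 1 1 2 0).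
Proof. by move=> gl; apply: dom_trans (dom_lip1 _ _ gl) dom_half_n1. Qed.

Lemma dom_half_taylor2 g G : taylor2 g G ->
  dom (fun p => g (half p) - g (x p) - \rsum_(k < d) (G (x p) k * (half p k - x p k)))
      (mono 2 2 4 0).
Proof.
move=> [K [K0 HK]]; apply: dom_trans (_ : dom _ (fun p => n1 (vsub (half p) (x p)) * n1 (vsub (half p) (x p)))) _.
  by exists K.
exact: domMm dom_half_n1 dom_half_n1.
Qed.

(** Compared with [dom_half_h], this gives up a power of [s] to keep growth linear in [N]: the
    fourth-power estimates for Q and V can afford a single power of [N] here. *)
Lemma dom_half_h_lin j k i :
  dom (fun p => hmil j k i (half p) - hmil j k i (x p)) (mono 0 1 2 0).
Proof.
apply: domB; last exact: dom_mono (dom_h j k i) _.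
apply: dom_sum => [p|q]; first exact: mono_ge0.
apply: (domMm (dom_bounded half (bnd_dsig j i q))).
apply: (eq_dom (f' := fun p => (sig k (half p) q - sig k (x p) q) + sig k (x p) q)).
  by move=> p; ring.
apply: domD; first exact: dom_mono (dom_half_lip1 (lip_sig k q)) _.
exact: dom_mono (dom_growth (lip_sig k q)) _.
Qed.

Lemma dom_half_h j k i :
  dom (fun p => hmil j k i (half p) - hmil j k i (x p)) (mono 1 2 2 0).
Proof.
apply: dom_trans (dom_dh j k i half) _.
apply: (domMm (i := 0) (n := 1) (k := 0) (l := 0) _ dom_half_n1).
by apply: dom_le => p; rewrite Rabs_pos_eq /mono /=; have := N_ge1 p; lra.
Qed.

Definition remp p i := rem (s p * s p) (x p) (half p) (a p) (b p) i.

Lemma dom_rem_lin i : dom (fun p => remp p i) (mono 2 1 2 2).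
Proof.
apply: domD.
  apply: dom_sum => [p|j]; first exact: mono_ge0.
  apply: dom_mono (domMm (_ : dom _ (mono 1 1 2 0)) (dom_b j)) _ => //.
  apply: domB; first exact: dom_half_lip1 (lip_sig j i).
  apply: dom_sum => [p|k]; first exact: mono_ge0.
  exact: dom_mono (domMm (dom_h j k i) (dom_a k)) _.
apply: domZ; apply: dom_sum => [p|j]; first exact: mono_ge0.
apply: dom_sum => [p|k]; first exact: mono_ge0.
exact: dom_mono (domMm (dom_half_h_lin j k i) (dom_qvar_b j k)) _.
Qed.

(* Two powers of [N] and a Taylor expansion of sigma buy the extra power of [s] over
   [dom_rem_lin]. *)
Lemma dom_rem i : dom (fun p => remp p i) (mono 3 2 4 2).
Proof.
apply: domD.
  apply: dom_sum => [p|j]; first exact: mono_ge0.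
  apply: dom_mono (domMm (_ : dom _ (mono 2 2 4 0)) (dom_b j)) _ => //.
  apply: (eq_dom (f' := fun p =>
     (sig j (half p) i - sig j (x p) i - \rsum_(q < d) (dsig j (x p) i q * (half p q - x p q)))
     + \rsum_(q < d) (dsig j (x p) i q * (half p q - x p q - \rsum_(k < m) (sig k (x p) q * a p k))))).
    move=> p; rewrite /hmil.
    have -> : \rsum_(k < m) ((\rsum_(q < d) (dsig j (x p) i q * sig k (x p) q)) * a p k)
      = \rsum_(q < d) (dsig j (x p) i q * \rsum_(k < m) (sig k (x p) q * a p k)).
      under eq_bigr => k _ do rewrite -rsumZr.
      rewrite exchange_big /=; apply: eq_bigr => q _; rewrite -rsumZ.
      by apply: eq_bigr => k _; ring.
    have -> : forall A B : R, A - B = A + (-1) * B by move=> *; ring.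
    have E (A B C : 'I_d -> R) : \rsum_(q < d) (A q * (B q - C q))
      = \rsum_(q < d) (A q * B q) - \rsum_(q < d) (A q * C q).
      by rewrite -rsumB; apply: eq_bigr => q _; ring.
    by rewrite (E _ (fun q => half p q - x p q)); ring.
  apply: domD; first exact: dom_half_taylor2 (tay_sig j i).
  apply: dom_sum => [p|q]; first exact: mono_ge0.
  exact: dom_mono (domMm (dom_bounded x (bnd_dsig j i q)) (dom_half_noise q)) _.
apply: domZ; apply: dom_sum => [p|j]; first exact: mono_ge0.
apply: dom_sum => [p|k]; first exact: mono_ge0.
exact: dom_mono (domMm (dom_half_h j k i) (dom_qvar_b j k)) _.
Qed.

(** First-order change of the drift caused by the mean-zero part of the half step: too large, at
    order s^3, to count as drift, but centered. *)
Definition drift_mart p i :=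
  s p * s p * \rsum_(k < d) (gmu i (x p) k * mart (s p * s p) (x p) (a p) k).

Lemma dom_drift_lin i :
  dom (fun p => s p * s p * (mu (half p) i - mu (x p) i)) (mono 3 1 2 0).
Proof. exact: dom_mono (domMm dom_s2 (dom_half_lip1 (lip_mu i))) _. Qed.

Lemma dom_drift_mart i : dom (fun p => drift_mart p i) (mono 3 1 2 0).
Proof.
apply: dom_mono (domMm dom_s2 (_ : dom _ (mono 1 1 2 0))) _ => //.
apply: dom_sum => [p|k]; first exact: mono_ge0.
apply: (domMm (i := 0) (n := 0) (k := 0) (l := 0)); first exact: dom_bounded (bnd_gmu i k).
apply: (eq_dom (f' := fun p => (half p k - x p k) - mu (x p) k * (s p * s p))).
  by move=> p; rewrite /half stepE; ring.
apply: domB; first exact: dom_half.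
exact: dom_mono (domMm (dom_growth (lip_mu k)) dom_s2) _.
Qed.

(** Two contributions remain, each s^2 times s^2: the Taylor remainder of [mu], and its gradient
    along the deterministic part of the half step. *)
Lemma dom_drift_bias i :
  dom (fun p => s p * s p * (mu (half p) i - mu (x p) i) - drift_mart p i) (mono 4 2 4 0).
Proof.
apply: (eq_dom (f' := fun p => s p * s p *
   ((mu (half p) i - mu (x p) i - \rsum_(k < d) (gmu i (x p) k * (half p k - x p k)))
   + \rsum_(k < d) (gmu i (x p) k * (mu (x p) k * (s p * s p)))))).
  move=> p; rewrite /drift_mart.
  have -> : \rsum_(k < d) (gmu i (x p) k * (half p k - x p k)) =
    \rsum_(k < d) (gmu i (x p) k * mart (s p * s p) (x p) (a p) k)
    + \rsum_(k < d) (gmu i (x p) k * (mu (x p) k * (s p * s p))).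
    by rewrite -rsumD; apply: eq_bigr => k _; rewrite /half stepE; ring.
  ring.
apply: dom_mono (domMm dom_s2 (_ : dom _ (mono 2 2 4 0))) _ => //.
apply: domD; first exact: dom_half_taylor2 (tay_mu i).
apply: dom_sum => [p|k]; first exact: mono_ge0.
by apply: dom_mono (domMm (dom_bounded x (bnd_gmu i k)) (domMm (dom_growth (lip_mu k)) dom_s2)) _.
Qed.
End OneTrajectory.

(** * The coupled coarse step *)

Section Coupled.
Variable S : R.

(** The step and its bounds belong to the state, so that constants obtained through [dom] hold for
    every level at once. *)
Record state := State {
  ss : R; sx : vec d; sy : vec d; sz : vec d; ss_gt0 : 0 < ss; ss_le : ss <= S }.

Let vm := 'I_m -> R.
Let J := (state * vm * vm)%type.
Let A1 (p : J) : vm := p.1.2.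
Let B1 (p : J) : vm := p.2.
Let sp (p : J) := ss p.1.1.

Definition nst (q : state) := 1 + n1 (sx q) + n1 (sy q) + n1 (sz q).
Let Np (p : J) := nst p.1.1.

(** The cruder local bounds involve at most [alpha ^ 2] of each increment and the finer ones at most
    [alpha ^ 4], that is [gam] and [gam ^ 2]. The fourth power of the former and the square of the
    latter both give [gam ^ 4]. *)
Definition gam (p : J) := alpha (sp p) (A1 p) ^ 2 * alpha (sp p) (B1 p) ^ 2.

Lemma gam_ge1 p : 1 <= gam p.
Proof.
have h1 := alpha_ge1 (A1 p) (ss_gt0 p.1.1); have h2 := alpha_ge1 (B1 p) (ss_gt0 p.1.1).
rewrite /gam /sp; have := pow_R1_Rle _ 2 h1; have := pow_R1_Rle _ 2 h2; nra.
Qed.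

Lemma sp_gt0 p : 0 < sp p. Proof. exact: ss_gt0. Qed.
Lemma sp_le p : sp p <= S. Proof. exact: ss_le. Qed.

Lemma nst_x q : 1 + n1 (sx q) <= nst q.
Proof. by rewrite /nst; have := n1_ge0 (sy q); have := n1_ge0 (sz q); lra. Qed.
Lemma nst_y q : 1 + n1 (sy q) <= nst q.
Proof. by rewrite /nst; have := n1_ge0 (sx q); have := n1_ge0 (sz q); lra. Qed.
Lemma nst_z q : 1 + n1 (sz q) <= nst q.
Proof. by rewrite /nst; have := n1_ge0 (sy q); have := n1_ge0 (sx q); lra. Qed.
Lemma nst_ge1 q : 1 <= nst q.
Proof. by have := nst_x q; have := n1_ge0 (sx q); lra. Qed.

(** * The Lyapunov function and the quantities it dominates *)

Definition lyapunov (s : R) (x y z : vec d) :=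
  \rsum_(i < d) (/ 2 * (x i + y i) - z i) ^ 2
  + \rsum_(i < d) (x i - z i) ^ 4 + \rsum_(i < d) (y i - z i) ^ 4
  + s ^ 4 * (1 + \rsum_(i < d) x i ^ 4 + \rsum_(i < d) y i ^ 4 + \rsum_(i < d) z i ^ 4).

Definition Wt (q : state) := lyapunov (ss q) (sx q) (sy q) (sz q).

Lemma pow4_ge0 u : 0 <= u ^ 4.
Proof. by have -> : u ^ 4 = (u ^ 2) ^ 2 by [ring]; apply: pow2_ge_0. Qed.

Lemma rsum_pow4_ge0 n (u : 'I_n -> R) : 0 <= \rsum_(i < n) u i ^ 4.
Proof. by apply: rsum_ge0 => i; apply: pow4_ge0. Qed.

Lemma lyapunov_ge (s : R) x y z :
  [/\ \rsum_(i < d) (/ 2 * (x i + y i) - z i) ^ 2 <= lyapunov s x y z,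
      \rsum_(i < d) (x i - z i) ^ 4 <= lyapunov s x y z,
      \rsum_(i < d) (y i - z i) ^ 4 <= lyapunov s x y z &
      s ^ 4 * (1 + \rsum_(i < d) x i ^ 4 + \rsum_(i < d) y i ^ 4 + \rsum_(i < d) z i ^ 4)
        <= lyapunov s x y z].
Proof.
rewrite /lyapunov.
have h1 : 0 <= \rsum_(i < d) (/ 2 * (x i + y i) - z i) ^ 2.
  by apply: rsum_ge0 => i; apply: pow2_ge_0.
have h2 : 0 <= \rsum_(i < d) (x i - z i) ^ 4 by exact: rsum_pow4_ge0.
have h3 : 0 <= \rsum_(i < d) (y i - z i) ^ 4 by exact: rsum_pow4_ge0.
have h4 := rsum_pow4_ge0 x; have h5 := rsum_pow4_ge0 y; have h6 := rsum_pow4_ge0 z.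
set V := 1 + _ + _ + _; have V0 : 0 <= V by rewrite /V; lra.
have := Rmult_le_pos _ _ (pow4_ge0 s) V0 => ?.
by split; lra.
Qed.

Lemma Wt_ge0 q : 0 <= Wt q.
Proof.
have [h _ _ _] := lyapunov_ge (ss q) (sx q) (sy q) (sz q); apply: Rle_trans h.
by apply: rsum_ge0 => i; apply: pow2_ge_0.
Qed.

Lemma pow4_convex u v : (u + v) ^ 4 <= 8 * (u ^ 4 + v ^ 4).
Proof.
(* This product equals the difference of the two sides. *)
have : 0 <= (u - v) ^ 2 * (5 * (u + v) ^ 2 + 2 * u ^ 2 + 2 * v ^ 2).
  apply: Rmult_le_pos; first exact: pow2_ge_0.
  by have := pow2_ge_0 (u + v); have := pow2_ge_0 u; have := pow2_ge_0 v; lra.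
lra.
Qed.

Lemma n1_pow4 n : exists C, 0 <= C /\ forall v : 'I_n -> R, n1 v ^ 4 <= C * \rsum_(i < n) v i ^ 4.
Proof.
rewrite /n1; elim: (index_enum _) => [|i r [C [C0 IH]]].
  by exists 0; split=> [|v]; [lra|rewrite !big_nil /=; lra].
exists (8 * (1 + C)); split=> [|v]; first lra.
rewrite !big_cons; have := IH v; move: (\big[Rplus/0]_(i <- r) Rabs (v i)) => a.
have -> : v i ^ 4 = Rabs (v i) ^ 4 by rewrite RPow_abs Rabs_pos_eq //; apply: pow4_ge0.
have := pow4_ge0 (Rabs (v i)).
have h0 : 0 <= \big[Rplus/0]_(i <- r) v i ^ 4 by apply: rsum_ge0 => k; apply: pow4_ge0.
move: (Rabs (v i)) (\big[Rplus/0]_(i <- r) v i ^ 4) h0 => b T T0 b0 h.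
have C8 := Rmult_le_pos _ _ C0 b0; have := pow4_convex b a; lra.
Qed.

Lemma n1_pow2 n : exists C, 0 <= C /\ forall v : 'I_n -> R, n1 v ^ 2 <= C * \rsum_(i < n) v i ^ 2.
Proof.
rewrite /n1; elim: (index_enum _) => [|i r [C [C0 IH]]].
  by exists 0; split=> [|v]; [lra|rewrite !big_nil /=; lra].
exists (2 * (1 + C)); split=> [|v]; first lra.
rewrite !big_cons; have := IH v; move: (\big[Rplus/0]_(i <- r) Rabs (v i)) => a.
have -> : v i ^ 2 = Rabs (v i) ^ 2 by rewrite RPow_abs Rabs_pos_eq //; apply: pow2_ge_0.
have := pow2_ge_0 (Rabs (v i)).
have h0 : 0 <= \big[Rplus/0]_(i <- r) v i ^ 2 by apply: rsum_ge0 => k; apply: pow2_ge_0.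
move: (Rabs (v i)) (\big[Rplus/0]_(i <- r) v i ^ 2) h0 => b T T0 b0 h.
have := pow2_ge_0 (a - b); have := Rmult_le_pos _ _ C0 b0; nra.
Qed.

Lemma dom_pow4D (f g h : state -> R) : dom (fun q => f q ^ 4) h -> dom (fun q => g q ^ 4) h ->
  dom (fun q => (f q + g q) ^ 4) h.
Proof.
move=> [C [C0 H]] [C' [C0' H']]; exists (8 * (C + C')); split=> [|q]; first lra.
have := H q; have := H' q; rewrite !Rabs_pos_eq; try exact: pow4_ge0.
move: (f q) (g q) => a b h1 h2.
by have := pow4_convex a b; lra.
Qed.

Lemma dom_pow2D (f g h : state -> R) : dom (fun q => f q ^ 2) h -> dom (fun q => g q ^ 2) h ->
  dom (fun q => (f q + g q) ^ 2) h.
Proof.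
move=> [C [C0 H]] [C' [C0' H']]; exists (2 * (C + C')); split=> [|q]; first lra.
have := H q; have := H' q; rewrite !Rabs_pos_eq; try exact: pow2_ge_0.
by have := pow2_ge_0 (f q - g q); nra.
Qed.

Lemma dom_Wt_xz : dom (fun q => n1 (vsub (sx q) (sz q)) ^ 4) Wt.
Proof.
have [C [C0 H]] := n1_pow4 d; exists C; split=> // q.
rewrite Rabs_pos_eq; last exact: pow4_ge0.
apply: Rle_trans (H _) _; apply: Rmult_le_compat_l => //.
by have [] := lyapunov_ge (ss q) (sx q) (sy q) (sz q).
Qed.

Lemma dom_Wt_yz : dom (fun q => n1 (vsub (sy q) (sz q)) ^ 4) Wt.
Proof.
have [C [C0 H]] := n1_pow4 d; exists C; split=> // q.
rewrite Rabs_pos_eq; last exact: pow4_ge0.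
apply: Rle_trans (H _) _; apply: Rmult_le_compat_l => //.
by have [] := lyapunov_ge (ss q) (sx q) (sy q) (sz q).
Qed.

Definition mid q : vec d := fun i => / 2 * (sx q i + sy q i) - sz q i.

Lemma dom_Wt_mid : dom (fun q => n1 (mid q) ^ 2) Wt.
Proof.
have [C [C0 H]] := n1_pow2 d; exists C; split=> // q.
rewrite Rabs_pos_eq; last exact: pow2_ge_0.
apply: Rle_trans (H _) _; apply: Rmult_le_compat_l => //.
by have [] := lyapunov_ge (ss q) (sx q) (sy q) (sz q).
Qed.

(** The purpose of the term s^4 V: it pays for each factor s N produced by linear growth. *)
Lemma dom_Wt_N : dom (fun q => (ss q * nst q) ^ 4) Wt.
Proof.
have dv (v : state -> vec d) :
    (forall q, \rsum_(i < d) v q i ^ 4 <= 1 + \rsum_(i < d) sx q i ^ 4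
       + \rsum_(i < d) sy q i ^ 4 + \rsum_(i < d) sz q i ^ 4) ->
    dom (fun q => (ss q * n1 (v q)) ^ 4) Wt.
  move=> Hv; have [C [C0 H]] := n1_pow4 d; exists C; split=> // q.
  rewrite Rabs_pos_eq; last exact: pow4_ge0.
  have [_ _ _ h] := lyapunov_ge (ss q) (sx q) (sy q) (sz q).
  apply: Rle_trans (Rmult_le_compat_l _ _ _ C0 h); rewrite Rpow_mult_distr.
  have -> : forall c a b, c * (a * b) = a * (c * b) by move=> *; ring.
  apply: Rmult_le_compat_l; first exact: pow4_ge0.
  by apply: Rle_trans (H _) _; apply: Rmult_le_compat_l.
have hx q := rsum_pow4_ge0 (sx q); have hy q := rsum_pow4_ge0 (sy q).
have hz q := rsum_pow4_ge0 (sz q).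
apply: (eq_dom (f' := fun q => (ss q * 1 + ss q * n1 (sx q) + ss q * n1 (sy q)
   + ss q * n1 (sz q)) ^ 4)); first by move=> q; rewrite /nst; ring.
apply: dom_pow4D; last by apply: dv => q; have := hx q; have := hy q; lra.
apply: dom_pow4D; last by apply: dv => q; have := hx q; have := hz q; lra.
apply: dom_pow4D; last by apply: dv => q; have := hz q; have := hy q; lra.
apply: dom_le => q; rewrite Rabs_pos_eq; last exact: pow4_ge0.
have [_ _ _ h] := lyapunov_ge (ss q) (sx q) (sy q) (sz q).
apply: Rle_trans h; rewrite Rpow_mult_distr; apply: Rmult_le_compat_l; first exact: pow4_ge0.
by have := hx q; have := hy q; have := hz q; rewrite /=; lra.
Qed.

(** * Centered terms *)

(* Zero conditional mean given the state, for any pair of admissible increment laws. *)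
Definition noise (M : J -> R) := forall (W : finType) (X Y : W -> vm) (G : R) (q : state),
  (0 < #|W|)%N -> good_increment (ss q) X G -> good_increment (ss q) Y G ->
  centered X Y (fun a b => M (q, a, b)).

Lemma eq_noise M M' : (forall p, M p = M' p) -> noise M' -> noise M.
Proof. by move=> E H W X Y G q W0 GX GY; apply: eq_centered (H W X Y G q W0 GX GY) => a b. Qed.

Lemma noiseD M M' : noise M -> noise M' -> noise (fun p => M p + M' p).
Proof. by move=> H H' W X Y G q W0 GX GY; apply: centeredD; [exact: (H W X Y G q)|exact: (H' W X Y G q)]. Qed.

Lemma noiseZ (c : state -> R) M : noise M -> noise (fun p => c p.1.1 * M p).
Proof. by move=> H W X Y G q W0 GX GY; apply: (centeredZ (c q)); exact: (H W X Y G q). Qed.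

Lemma noiseZc (c : R) M : noise M -> noise (fun p => c * M p).
Proof. exact: (@noiseZ (fun _ => c)). Qed.

Lemma noiseB M M' : noise M -> noise M' -> noise (fun p => M p - M' p).
Proof. by move=> H /(noiseZc (-1)) H'; apply: eq_noise (noiseD H H') => p; ring. Qed.

Lemma noise_sum n (F : 'I_n -> J -> R) : (forall i, noise (F i)) -> noise (fun p => \rsum_(i < n) F i p).
Proof. by move=> H W X Y G q W0 GX GY; apply: centered_sum => i; exact: (H i W X Y G q). Qed.

(** The antithetic path consumes the increments in the opposite order. Quantifying over both laws in
    [noise] makes the exchange legitimate. *)
Lemma noise_swap M : noise M -> noise (fun p => M (p.1.1, p.2, p.1.2)).
Proof.
move=> H W X Y G q W0 GX GY.
by apply: (centered_swap (F := fun a b => M (q, a, b))); exact: (H W Y X G q).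
Qed.

Lemma noise_b (H : state -> vm -> R) j : noise (fun p => H p.1.1 p.1.2 * p.2 j).
Proof. by move=> W X Y G q W0 GX GY; exact: (centered_b X W0 GY (H q)). Qed.

Lemma noise_bb (H : state -> vm -> R) j k :
  noise (fun p => H p.1.1 p.1.2 * qvar (sp p * sp p) p.2 j k).
Proof. by move=> W X Y G q W0 GX GY; exact: (centered_bb X W0 GY (H q)). Qed.

Lemma noise_a (H : state -> R) j : noise (fun p => H p.1.1 * p.1.2 j).
Proof. exact: (noise_swap (noise_b (fun q _ => H q) j)). Qed.

Lemma noise_aa (H : state -> R) j k : noise (fun p => H p.1.1 * qvar (sp p * sp p) p.1.2 j k).
Proof. exact: (noise_swap (noise_bb (fun q _ => H q) j k)). Qed.

Lemma noise_mart (v : state -> vec d) i :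
  noise (fun p => mart (2 * (sp p * sp p)) (v p.1.1) (fun j => A1 p j + B1 p j) i).
Proof.
apply: noiseD.
  apply: noise_sum => j; apply: (eq_noise (M' := fun p =>
     sig j (v p.1.1) i * p.1.2 j + sig j (v p.1.1) i * p.2 j)).
    by move=> p; rewrite /A1 /B1; ring.
  by apply: noiseD; [apply: (noise_a (fun q => sig j (v q) i))|apply: (noise_b (fun q _ => sig j (v q) i))].
apply: noiseZc; apply: noise_sum => j; apply: noise_sum => k.
apply: (eq_noise (M' := fun p =>
   hmil j k i (v p.1.1) * qvar (sp p * sp p) p.1.2 j k
   + hmil j k i (v p.1.1) * qvar (sp p * sp p) p.2 j k
   + hmil j k i (v p.1.1) * p.1.2 k * p.2 j + hmil j k i (v p.1.1) * p.1.2 j * p.2 k)).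
  by move=> p; rewrite /qvar /A1 /B1; case: (j == k); ring.
apply: noiseD; last exact: (noise_b (fun q a => hmil j k i (v q) * a j)).
apply: noiseD; last exact: (noise_b (fun q a => hmil j k i (v q) * a k)).
apply: noiseD; last exact: (noise_bb (fun q _ => hmil j k i (v q))).
exact: (noise_aa (fun q => hmil j k i (v q))).
Qed.

Lemma noise_levy (v : state -> vec d) i : noise (fun p => levy (v p.1.1) (A1 p) (B1 p) i).
Proof.
apply: noiseZc; apply: noise_sum => j; apply: noise_sum => k.
apply: (eq_noise (M' := fun p => hmil j k i (v p.1.1) * p.1.2 k * p.2 j
  - hmil j k i (v p.1.1) * p.1.2 j * p.2 k)); first by move=> p; rewrite /A1 /B1; ring.
apply: noiseB; first exact: (noise_b (fun q a => hmil j k i (v q) * a k)).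
exact: (noise_b (fun q a => hmil j k i (v q) * a j)).
Qed.

Lemma noise_rem (v : state -> vec d) i :
  noise (fun p => remp sp (fun p => v p.1.1) A1 B1 p i).
Proof.
apply: noiseD.
  apply: noise_sum => j.
  exact: (noise_b (fun q a => sig j (step (ss q * ss q) (v q) a) i - sig j (v q) i
     - \rsum_(k < m) (hmil j k i (v q) * a k))).
apply: noiseZc; apply: noise_sum => j; apply: noise_sum => k.
exact: (noise_bb (fun q a => hmil j k i (step (ss q * ss q) (v q) a) - hmil j k i (v q))).
Qed.

Lemma noise_drift (v : state -> vec d) i :
  noise (fun p => drift_mart sp (fun p => v p.1.1) A1 p i).
Proof.
apply: (noiseZ (fun q => ss q * ss q)); apply: noise_sum => k.
apply: (noiseZ (fun q => gmu i (v q) k)); apply: noiseD.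
  by apply: noise_sum => j; apply: (noise_a (fun q => sig j (v q) k)).
apply: noiseZc; apply: noise_sum => j; apply: noise_sum => l.
exact: (noise_aa (fun q => hmil j l k (v q))).
Qed.

(** * One-step growth of the Lyapunov function *)

(** The error is always measured by the whole of [Wt], so one summand of the Lyapunov function may
    borrow from the others, while the property stays additive in [F]. *)
Definition growth (F' : J -> R) (F : state -> R) := exists C M, 0 <= C /\ noise M /\
  forall p, F' p <= F p.1.1 + M p + C * (sp p * sp p) * Wt p.1.1 * gam p ^ 4.

Lemma growthD F' F G' G : growth F' F -> growth G' G ->
  growth (fun p => F' p + G' p) (fun q => F q + G q).
Proof.
move=> [C [M [C0 [cM H]]]] [C' [M' [C0' [cM' H']]]].
exists (C + C'), (fun p => M p + M' p); split; first lra.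
split; first exact: noiseD.
by move=> p; have := H p; have := H' p; lra.
Qed.

Lemma growth_sum n (F' : 'I_n -> J -> R) (F : 'I_n -> state -> R) : (forall i, growth (F' i) (F i)) ->
  growth (fun p => \rsum_(i < n) F' i p) (fun q => \rsum_(i < n) F i q).
Proof.
move=> H; elim: (index_enum _) => [|i r IH].
  exists 0, (fun p => 0 * 0); split; first lra; split.
    by move=> W X Y G q W0 GX GY; rewrite /centered -[RHS](EE_cst X Y W0 0); apply: eq_EE => *; ring.
  by move=> p; rewrite !big_nil; lra.
have [C [M [C0 [cM HM]]]] := growthD (H i) IH; exists C, M; split=> //; split=> // p.
by rewrite !big_cons; apply: HM.
Qed.

Lemma eq_growth F' F G' G : (forall p, F' p = G' p) -> (forall q, F q = G q) -> growth G' G -> growth F' F.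
Proof. by move=> E E' [C [M [C0 [cM H]]]]; exists C, M; do 2 split=> //; move=> p; rewrite E E'. Qed.

(** The term linear in [v] stays exact because its noise part has to average out; 4 u v^3 <= 2 u^2
    v^2 + 2 v^4 removes the other odd term. *)
Lemma quartic_expand u v : (u + v) ^ 4 <= u ^ 4 + 4 * u ^ 3 * v + 8 * u ^ 2 * v ^ 2 + 3 * v ^ 4.
Proof.
have : 0 <= v ^ 2 * (u - v) ^ 2 by apply: Rmult_le_pos; apply: pow2_ge_0.
nra.
Qed.

Lemma young31 u v : 0 <= v -> Rabs u ^ 3 * v <= u ^ 4 + v ^ 4.
Proof.
have -> : u ^ 4 = Rabs u ^ 4 by rewrite RPow_abs Rabs_pos_eq //; apply: pow4_ge0.
move: (Rabs u) (Rabs_pos u) => t t0 v0.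
have a0 := pow_le _ 3 t0; have b0 := pow_le _ 3 v0.
have -> : t ^ 4 = t ^ 3 * t by ring.
have -> : v ^ 4 = v ^ 3 * v by ring.
case: (Rle_lt_dec v t) => h.
  by have := Rmult_le_compat_l _ _ _ a0 h; have := Rmult_le_pos _ _ b0 v0; lra.
have h3 : t ^ 3 <= v ^ 3 by apply: pow_incr; lra.
by have := Rmult_le_compat_r _ _ _ v0 h3; have := Rmult_le_pos _ _ a0 t0; lra.
Qed.

Lemma young22 u v : u ^ 2 * v ^ 2 <= u ^ 4 + v ^ 4.
Proof. by have := pow2_ge_0 (u ^ 2 - v ^ 2); have := pow4_ge0 u; have := pow4_ge0 v; nra. Qed.

(** Discrete counterpart of the Ito formula for u^4: noise of size s A enters to first order only
    through a centered term, so all that is left carries s^2. The weight [c] is s^4 for V and 1 for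
    Q. *)
Lemma growth_quartic (c u A : state -> R) (M B : J -> R) :
  (forall q, 0 <= c q) -> (forall q, 0 <= A q) -> noise M ->
  dom M (fun p => sp p * A p.1.1 * gam p) ->
  dom B (fun p => sp p * sp p * A p.1.1 * gam p) ->
  dom (fun q => c q * u q ^ 4) Wt -> dom (fun q => c q * A q ^ 4) Wt ->
  growth (fun p => c p.1.1 * (u p.1.1 + (M p + B p)) ^ 4) (fun q => c q * u q ^ 4).
Proof.
move=> c0 A0 cM [C1 [C10 H1]] [C2 [C20 H2]] [Cu [Cu0 Hu]] [Ca [Ca0 Ha]].
pose C3 := C1 + C2 * Rabs S.
have C30 : 0 <= C3 by rewrite /C3; have := Rmult_le_pos _ _ C20 (Rabs_pos S); lra.
(* [C3] bounds [M + B] by s A gam. The three summands belong to [i1], [i2] and [i3], one for each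
   term of [quartic_expand]; the last has s^4, of which s^2 is spent on S^2. *)
pose K := 4 * C2 + 8 * C3 ^ 2 + 3 * C3 ^ 4 * Rabs S ^ 2.
have K0 : 0 <= K.
  have ? := pow2_ge_0 C3; have ? := pow2_ge_0 (Rabs S).
  by have := Rmult_le_pos _ _ (pow4_ge0 C3) (pow2_ge_0 (Rabs S)); rewrite /K; lra.
exists (K * (Cu + Ca)), (fun p => (c p.1.1 * (4 * u p.1.1 ^ 3)) * M p).
split; first by apply: Rmult_le_pos => //; lra.
split; first exact: (noiseZ (fun q => c q * (4 * u q ^ 3))).
move=> p; have cp := c0 p.1.1; have Ap := A0 p.1.1.
have := H1 p; have := H2 p; have := Rle_trans _ _ _ (Rle_abs _) (Hu p.1.1);
  have := Rle_trans _ _ _ (Rle_abs _) (Ha p.1.1); have := gam_ge1 p.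
have := sp_gt0 p; have := Rle_trans _ _ _ (sp_le p) (Rle_abs S).
move: (sp p) (gam p) (M p) (B p) (Wt _) (u _) (A _) (c _) cp Ap (Rabs S) @C3 C30 @K K0
  => s g Mp Bp w up Ap cp cp0 Ap0 S' C3 C30 K K0 sS' s0 g1 ha hu hB hM.
have Ag0 : 0 <= Ap * g by apply: Rmult_le_pos; lra.
have hI : Rabs (Mp + Bp) <= C3 * (s * (Ap * g)).
  apply: Rle_trans (Rabs_triang _ _) _.
  have : C2 * (s * s * Ap * g) <= C2 * (S' * (s * (Ap * g))).
    apply: Rmult_le_compat_l => //.
    have -> : s * s * Ap * g = s * (s * (Ap * g)) by ring.
    by apply: Rmult_le_compat_r => //; apply: Rmult_le_pos; lra.
  rewrite /C3; have -> : (C1 + C2 * S') * (s * (Ap * g)) = C1 * (s * Ap * g) + C2 * (S' * (s * (Ap * g))) by ring.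
  lra.
have Q0 : 0 <= up ^ 4 + Ap ^ 4 by have := pow4_ge0 up; have := pow4_ge0 Ap; lra.
have g2 : g ^ 2 <= g ^ 4 by apply: Rle_pow => //; apply/leP.
have g4 : g <= g ^ 4 by rewrite -{1}(pow_1 g); apply: Rle_pow => //; apply/leP.
have g40 := pow4_ge0 g.
have ss0 : 0 <= s * s by nra.
have i1 : 4 * up ^ 3 * Bp <= 4 * C2 * (s * s * (up ^ 4 + Ap ^ 4) * g ^ 4).
  have : up ^ 3 * Bp <= C2 * (s * s * (up ^ 4 + Ap ^ 4) * g ^ 4).
    apply: Rle_trans (Rle_abs _) _; rewrite Rabs_mult -RPow_abs.
    have h3 := pow_le _ 3 (Rabs_pos up).
    apply: Rle_trans (Rmult_le_compat_l _ _ _ h3 hB) _.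
    have -> : Rabs up ^ 3 * (C2 * (s * s * Ap * g)) = C2 * (s * s * (Rabs up ^ 3 * Ap) * g) by ring.
    apply: Rmult_le_compat_l => //; apply: Rmult_le_compat => //; try lra.
      by apply: Rmult_le_pos => //; apply: Rmult_le_pos.
    by apply: Rmult_le_compat_l => //; apply: young31.
  lra.
have i2 : 8 * up ^ 2 * (Mp + Bp) ^ 2 <= 8 * C3 ^ 2 * (s * s * (up ^ 4 + Ap ^ 4) * g ^ 4).
  have h2 : (Mp + Bp) ^ 2 <= (C3 * (s * (Ap * g))) ^ 2.
    by rewrite -(pow2_abs (Mp + Bp)); apply: pow_incr; split; [exact: Rabs_pos|].
  have u2 := pow2_ge_0 up.
  have := Rmult_le_compat_l _ _ _ u2 h2.
  have -> : up ^ 2 * (C3 * (s * (Ap * g))) ^ 2 = C3 ^ 2 * (s * s * (up ^ 2 * Ap ^ 2) * g ^ 2) by ring.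
  have : C3 ^ 2 * (s * s * (up ^ 2 * Ap ^ 2) * g ^ 2) <= C3 ^ 2 * (s * s * (up ^ 4 + Ap ^ 4) * g ^ 4).
    apply: Rmult_le_compat_l; first exact: pow2_ge_0.
    apply: Rmult_le_compat => //; try exact: pow2_ge_0.
      by apply: Rmult_le_pos => //; apply: Rmult_le_pos; apply: pow2_ge_0.
    by apply: Rmult_le_compat_l => //; apply: young22.
  lra.
have i3 : 3 * (Mp + Bp) ^ 4 <= 3 * C3 ^ 4 * S' ^ 2 * (s * s * (up ^ 4 + Ap ^ 4) * g ^ 4).
  have h4 : (Mp + Bp) ^ 4 <= (C3 * (s * (Ap * g))) ^ 4.
    have -> : (Mp + Bp) ^ 4 = Rabs (Mp + Bp) ^ 4.
      by rewrite RPow_abs Rabs_pos_eq //; apply: pow4_ge0.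
    by apply: pow_incr; split; [exact: Rabs_pos|].
  have : (C3 * (s * (Ap * g))) ^ 4 <= C3 ^ 4 * S' ^ 2 * (s * s * (up ^ 4 + Ap ^ 4) * g ^ 4).
    have -> : (C3 * (s * (Ap * g))) ^ 4 = C3 ^ 4 * (s ^ 2 * (s * s * Ap ^ 4 * g ^ 4)) by ring.
    rewrite (Rmult_assoc (C3 ^ 4)); apply: Rmult_le_compat_l; first exact: pow4_ge0.
    have p4 := pow4_ge0 Ap; have q4 := pow4_ge0 up.
    apply: Rmult_le_compat; first exact: pow2_ge_0.
    - by apply: Rmult_le_pos => //; apply: Rmult_le_pos.
    - by apply: pow_incr; lra.
    by apply: Rmult_le_compat_r => //; apply: Rmult_le_compat_l => //; lra.
  lra.
have := quartic_expand up (Mp + Bp).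
set X := s * s * (up ^ 4 + Ap ^ 4) * g ^ 4 in i1 i2 i3.
have hX : cp * (K * X) <= K * (Cu + Ca) * (s * s) * w * g ^ 4.
  have -> : cp * (K * X) = K * (s * s * (cp * up ^ 4 + cp * Ap ^ 4) * g ^ 4) by rewrite /X; ring.
  have -> : K * (Cu + Ca) * (s * s) * w * g ^ 4 = K * (s * s * (Cu * w + Ca * w) * g ^ 4) by ring.
  apply: Rmult_le_compat_l => //; apply: Rmult_le_compat_r => //.
  by apply: Rmult_le_compat_l => //; lra.
move=> hq.
have := Rmult_le_compat_l _ _ _ cp0 hq.
have : cp * (4 * up ^ 3 * Bp + 8 * up ^ 2 * (Mp + Bp) ^ 2 + 3 * (Mp + Bp) ^ 4) <= cp * (K * X).
  by apply: Rmult_le_compat_l => //; rewrite /K; lra.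
lra.
Qed.

(* Second moments only need the sizes up to [gam ^ 2]: [gam ^ 4] is what the eighth
   moments of the increments integrate. *)
Lemma growth_square (u A : state -> R) (M B : J -> R) :
  (forall q, 0 <= A q) -> noise M ->
  dom M (fun p => sp p * A p.1.1 * gam p ^ 2) ->
  dom B (fun p => sp p * sp p * A p.1.1 * gam p ^ 2) ->
  dom (fun q => u q ^ 2) Wt -> dom (fun q => A q ^ 2) Wt ->
  growth (fun p => (u p.1.1 + (M p + B p)) ^ 2) (fun q => u q ^ 2).
Proof.
move=> A0 cM [C1 [C10 H1]] [C2 [C20 H2]] [Cu [Cu0 Hu]] [Ca [Ca0 Ha]].
pose C3 := C1 + C2 * Rabs S.
have C30 : 0 <= C3 by rewrite /C3; have := Rmult_le_pos _ _ C20 (Rabs_pos S); lra.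
pose K := C2 + C3 ^ 2.
have K0 : 0 <= K by have := pow2_ge_0 C3; rewrite /K; lra.
exists (K * (Cu + Ca)), (fun p => (2 * u p.1.1) * M p).
split; first by apply: Rmult_le_pos => //; lra.
split; first exact: (noiseZ (fun q => 2 * u q)).
move=> p; have Ap := A0 p.1.1.
have := H1 p; have := H2 p; have := Rle_trans _ _ _ (Rle_abs _) (Hu p.1.1);
  have := Rle_trans _ _ _ (Rle_abs _) (Ha p.1.1); have := gam_ge1 p.
have := sp_gt0 p; have := Rle_trans _ _ _ (sp_le p) (Rle_abs S).
move: (sp p) (gam p) (M p) (B p) (Wt _) (u _) (A _) Ap (Rabs S) @C3 C30 @K K0
  => s g Mp Bp w up Ap Ap0 S' C3 C30 K K0 sS' s0 g1 ha hu hB hM.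
have Ag0 : 0 <= Ap * g ^ 2 by apply: Rmult_le_pos => //; apply: pow2_ge_0.
have hI : Rabs (Mp + Bp) <= C3 * (s * (Ap * g ^ 2)).
  apply: Rle_trans (Rabs_triang _ _) _.
  have : C2 * (s * s * Ap * g ^ 2) <= C2 * (S' * (s * (Ap * g ^ 2))).
    apply: Rmult_le_compat_l => //.
    have -> : s * s * Ap * g ^ 2 = s * (s * (Ap * g ^ 2)) by ring.
    by apply: Rmult_le_compat_r => //; apply: Rmult_le_pos; lra.
  rewrite /C3; have -> : (C1 + C2 * S') * (s * (Ap * g ^ 2)) = C1 * (s * Ap * g ^ 2) + C2 * (S' * (s * (Ap * g ^ 2))) by ring.
  lra.
have g2 : g ^ 2 <= g ^ 4 by apply: Rle_pow => //; apply/leP.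
have g40 := pow4_ge0 g; have g20 := pow2_ge_0 g.
have ss0 : 0 <= s * s by nra.
have u20 := pow2_ge_0 up; have A20 := pow2_ge_0 Ap.
set X := s * s * (up ^ 2 + Ap ^ 2) * g ^ 4.
have i1 : 2 * up * Bp <= C2 * X.
  apply: Rle_trans (Rle_abs _) _; rewrite !Rabs_mult (Rabs_pos_eq 2); last lra.
  have h0 : 0 <= 2 * Rabs up by have := Rabs_pos up; lra.
  apply: Rle_trans (Rmult_le_compat_l _ _ _ h0 hB) _.
  have -> : 2 * Rabs up * (C2 * (s * s * Ap * g ^ 2)) = C2 * (s * s * (2 * Rabs up * Ap) * g ^ 2) by ring.
  apply: Rmult_le_compat_l => //; apply: Rmult_le_compat => //.
    by apply: Rmult_le_pos => //; apply: Rmult_le_pos.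
  apply: Rmult_le_compat_l => //; rewrite -(pow2_abs up).
  by have := pow2_ge_0 (Rabs up - Ap); lra.
have i2 : (Mp + Bp) ^ 2 <= C3 ^ 2 * X.
  have h2 : (Mp + Bp) ^ 2 <= (C3 * (s * (Ap * g ^ 2))) ^ 2.
    by rewrite -(pow2_abs (Mp + Bp)); apply: pow_incr; split; [exact: Rabs_pos|].
  apply: Rle_trans h2 _.
  have -> : (C3 * (s * (Ap * g ^ 2))) ^ 2 = C3 ^ 2 * (s * s * Ap ^ 2 * g ^ 4) by ring.
  apply: Rmult_le_compat_l; first exact: pow2_ge_0.
  by apply: Rmult_le_compat_r => //; apply: Rmult_le_compat_l => //; lra.
have hX : K * X <= K * (Cu + Ca) * (s * s) * w * g ^ 4.
  have -> : K * (Cu + Ca) * (s * s) * w * g ^ 4 = K * (s * s * (Cu * w + Ca * w) * g ^ 4) by ring.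
  apply: Rmult_le_compat_l => //; apply: Rmult_le_compat_r => //.
  by apply: Rmult_le_compat_l => //; lra.
have -> : (up + (Mp + Bp)) ^ 2 = up ^ 2 + 2 * up * Mp + 2 * up * Bp + (Mp + Bp) ^ 2 by ring.
move: hX; rewrite {1}/K; lra.
Qed.

(** * Orders of the noise and drift terms of a coarse step *)

Definition xnew p := step (sp p * sp p) (step (sp p * sp p) (sx p.1.1) (A1 p)) (B1 p).
Definition ynew p := step (sp p * sp p) (step (sp p * sp p) (sy p.1.1) (B1 p)) (A1 p).
Definition znew p := step (2 * (sp p * sp p)) (sz p.1.1) (fun j => A1 p j + B1 p j).

(** Symmetry of [gam] lets the estimates for one fine path serve both [x], driven by [A1] then [B1],
    and [y], driven in reverse. *)
Definition same_gam (a b : J -> vm) :=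
  forall p, alpha (sp p) (a p) ^ 2 * alpha (sp p) (b p) ^ 2 = gam p.

Lemma same_gam_ab : same_gam A1 B1. Proof. by []. Qed.
Lemma same_gam_ba : same_gam B1 A1. Proof. by move=> p; rewrite Rmult_comm. Qed.

Lemma mono_gam (a b : J -> vm) f i n k l : same_gam a b -> (k <= 2)%N && (l <= 2)%N ->
  dom f (mono sp Np a b i n k l) -> dom f (fun p => sp p ^ i * Np p ^ n * gam p).
Proof.
move=> E kl H; apply: dom_wider (dom_mono sp_gt0 sp_le (fun p => nst_x p.1.1)
  (i' := i) (n' := n) (k' := 2%N) (l' := 2%N) H _) => [p|].
  by rewrite /mono -E Rmult_assoc; apply: Rle_refl.
by rewrite !leqnn /=.
Qed.

Lemma mono_gam2 (a b : J -> vm) f i n k l : same_gam a b -> (k <= 4)%N && (l <= 4)%N ->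
  dom f (mono sp Np a b i n k l) -> dom f (fun p => sp p ^ i * Np p ^ n * gam p ^ 2).
Proof.
move=> E kl H; apply: dom_wider (dom_mono sp_gt0 sp_le (fun p => nst_x p.1.1)
  (i' := i) (n' := n) (k' := 4%N) (l' := 4%N) H _) => [p|].
  by rewrite /mono -E /Np; apply: Req_le; ring.
by rewrite !leqnn /=.
Qed.

Lemma gam_pow_ge1 p k : 1 <= gam p ^ k.
Proof. by apply: pow_R1_Rle; exact: gam_ge1. Qed.

Lemma dom_lift (f A : state -> R) (g : J -> R) : (forall p, 0 <= g p) -> dom f A ->
  dom (fun p => f p.1.1 * g p) (fun p => A p.1.1 * g p).
Proof.
move=> g0 [C [C0 H]]; exists C; split=> // p.
rewrite Rabs_mult (Rabs_pos_eq (g p)) // -Rmult_assoc.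
exact: Rmult_le_compat_r.
Qed.

(** Puts a monomial bound into the shape demanded of noise by [growth_quartic] and [growth_square]:
    one [s] is kept and s^i N^n is absorbed into [A]. *)
Lemma dom_gam_wider (f : J -> R) i n (A : state -> R) j k : (j <= k)%N ->
  dom f (fun p => sp p ^ i.+1 * Np p ^ n * gam p ^ j) -> (forall q, 0 <= A q) ->
  dom (fun q => ss q ^ i * nst q ^ n) A -> dom f (fun p => sp p * A p.1.1 * gam p ^ k).
Proof.
move=> jk H A0 HA.
have gk0 p : 0 <= sp p * gam p ^ k.
  by apply: Rmult_le_pos; [have := sp_gt0 p|have := gam_pow_ge1 p k]; lra.
apply: (dom_wider (g := fun p => A p.1.1 * (sp p * gam p ^ k))) => [p|].
  by apply: Req_le; ring.
apply: dom_trans H _; apply: dom_trans (dom_lift gk0 HA).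
apply: dom_le => p.
have sN0 : 0 <= sp p ^ i * Np p ^ n.
  apply: Rmult_le_pos; apply: pow_le; first by have := sp_gt0 p; lra.
  by have := nst_ge1 p.1.1; rewrite /Np; lra.
have -> : sp p ^ i.+1 * Np p ^ n * gam p ^ j = sp p ^ i * Np p ^ n * (sp p * gam p ^ j).
  by rewrite -tech_pow_Rmult; ring.
have s0 := sp_gt0 p.
rewrite Rabs_pos_eq; last first.
  by apply: Rmult_le_pos => //; apply: Rmult_le_pos; [|have := gam_pow_ge1 p j]; lra.
apply: Rmult_le_compat_l => //; apply: Rmult_le_compat_l; first lra.
by apply: Rle_pow; [exact: gam_ge1|apply/leP].
Qed.

Lemma dom_ab_gam j : dom (fun p => A1 p j + B1 p j) (fun p => sp p * gam p).
Proof.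
have := mono_gam same_gam_ab _ (dom_ab A1 B1 sp_gt0 sp_le (fun p => nst_x p.1.1) j).
by move=> /(_ isT); apply: dom_wider => p; apply: Req_le; ring.
Qed.

Lemma dom_qvar_gam j k :
  dom (fun p => qvar (2 * (sp p * sp p)) (fun j => A1 p j + B1 p j) j k)
      (fun p => sp p * sp p * gam p).
Proof.
have := mono_gam same_gam_ab _ (dom_qvar_ab A1 B1 sp_gt0 sp_le (fun p => nst_x p.1.1) j k).
by move=> /(_ isT); apply: dom_wider => p; apply: Req_le; ring.
Qed.

Lemma dom_area_gam j k :
  dom (fun p => A1 p k * B1 p j - A1 p j * B1 p k) (fun p => sp p * sp p * gam p).
Proof.
have := mono_gam same_gam_ab _ (dom_levy_area Np A1 B1 sp_gt0 j k).
by move=> /(_ isT); apply: dom_wider => p; apply: Req_le; ring.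
Qed.

Lemma sAgam_ge0 (A : state -> R) k p : 0 <= A p.1.1 -> 0 <= sp p * A p.1.1 * gam p ^ k.
Proof.
move=> A0; have := gam_ge1 p; have := sp_gt0 p => ? ?.
by repeat apply: Rmult_le_pos => //; try apply: pow_le; lra.
Qed.

(* The noise terms of a coarse step, for coefficients [c] of size [A] and [h] of size [H]. *)
Lemma dom_martc (c : 'I_m -> J -> R) (h : 'I_m -> 'I_m -> J -> R) (A H : state -> R) :
  (forall q, 0 <= A q) -> dom (fun q => ss q * H q) A ->
  (forall j, dom (c j) (fun p => A p.1.1)) -> (forall j k, dom (h j k) (fun p => H p.1.1)) ->
  dom (fun p => \rsum_(j < m) (c j p * (A1 p j + B1 p j))
    + / 2 * \rsum_(j < m) \rsum_(k < m)
        (h j k p * qvar (2 * (sp p * sp p)) (fun j => A1 p j + B1 p j) j k))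
   (fun p => sp p * A p.1.1 * gam p).
Proof.
move=> A0 HA dc dh; have g0 p : 0 <= sp p * A p.1.1 * gam p.
  by have := sAgam_ge0 1 (A0 p.1.1); rewrite pow_1.
apply: domD.
  apply: dom_sum => // j.
  by apply: dom_wider (domM (dc j) (dom_ab_gam j)) => p; apply: Req_le; ring.
apply: domZ; apply: dom_sum => // j; apply: dom_sum => // k.
apply: dom_trans (domM (dh j k) (dom_qvar_gam j k)) _.
have sg0 p : 0 <= sp p * gam p.
  by apply: Rmult_le_pos; [have := sp_gt0 p|have := gam_ge1 p]; lra.
apply: (eq_dom (f' := fun p => ss p.1.1 * H p.1.1 * (sp p * gam p))).
  by move=> p; rewrite /sp; ring.
by apply: dom_wider (dom_lift sg0 HA) => p; apply: Req_le; ring.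
Qed.

(** * Local terms along one fine path, for either order of the increments *)

Section Side.
Variables (v : state -> vec d) (a b : J -> vm).
Hypothesis vN : forall q, 1 + n1 (v q) <= nst q.
Hypothesis abg : same_gam a b.
Let vp (p : J) := v p.1.1.
Let vNp (p : J) : 1 + n1 (vp p) <= Np p := vN p.1.1.

Lemma dom_v_growth g : lip1 g -> dom (fun p => g (vp p)) (fun p : J => nst p.1.1).
Proof.
move=> gl; apply: dom_wider (dom_growth sp a b vNp gl) => p.
by rewrite /mono /Np /=; lra.
Qed.

Lemma dom_v_h j k i : dom (fun p => hmil j k i (vp p)) (fun p : J => nst p.1.1).
Proof.
apply: dom_wider (dom_h a b sp_gt0 vNp j k i) => p.
by rewrite /mono /Np /=; lra.
Qed.

Definition levyp p i := levy (vp p) (a p) (b p) i.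
Definition remv p i := remp sp vp a b p i.
Definition ddrift p i := sp p * sp p * (mu (half sp vp a p) i - mu (vp p) i).
Definition driftm p i := drift_mart sp vp a p i.

Lemma dom_levyp i : dom (fun p => levyp p i) (fun p => sp p ^ 2 * Np p ^ 1 * gam p).
Proof.
apply: (mono_gam (k := 1) (l := 1) abg) => //.
apply: domZ; apply: dom_sum => [p|j]; first exact: mono_ge0 sp_gt0 vNp _ _ _ _ _.
apply: dom_sum => [p|k]; first exact: mono_ge0 sp_gt0 vNp _ _ _ _ _.
exact: (domMm (dom_h a b sp_gt0 vNp j k i) (dom_levy_area Np a b sp_gt0 j k)).
Qed.

Lemma dom_remv_lin i : dom (fun p => remv p i) (fun p => sp p ^ 2 * Np p ^ 1 * gam p).
Proof. exact: mono_gam abg _ (dom_rem_lin a b sp_gt0 sp_le vNp i). Qed.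

Lemma dom_remv i : dom (fun p => remv p i) (fun p => sp p ^ 3 * Np p ^ 2 * gam p ^ 2).
Proof. exact: mono_gam2 abg _ (dom_rem a b sp_gt0 sp_le vNp i). Qed.

Lemma dom_ddrift i : dom (fun p => ddrift p i) (fun p => sp p ^ 3 * Np p ^ 1 * gam p).
Proof. exact: mono_gam abg _ (dom_drift_lin a b sp_gt0 sp_le vNp i). Qed.

Lemma dom_driftm i : dom (fun p => driftm p i) (fun p => sp p ^ 3 * Np p ^ 2 * gam p ^ 2).
Proof.
apply: (mono_gam2 (i := 3) (n := 2) (k := 2) (l := 0) abg) => //.
exact: (dom_mono sp_gt0 sp_le vNp (dom_drift_mart a b sp_gt0 sp_le vNp i)).
Qed.

Lemma dom_driftb i :
  dom (fun p => ddrift p i - driftm p i) (fun p => sp p ^ 4 * Np p ^ 2 * gam p ^ 2).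
Proof. exact: mono_gam2 abg _ (dom_drift_bias a b sp_gt0 sp_le vNp i). Qed.
End Side.

Definition martp (v : state -> vec d) p i :=
  mart (2 * (sp p * sp p)) (v p.1.1) (fun j => A1 p j + B1 p j) i.

Lemma ss_bound q : ss q <= Rabs S.
Proof. by apply: Rle_trans (ss_le q) (Rle_abs S). Qed.

Lemma dom_ss_mul (A : state -> R) : (forall q, 0 <= A q) -> dom (fun q => ss q * A q) A.
Proof.
move=> A0; exists (Rabs S); split=> [|q]; first exact: Rabs_pos.
have := ss_gt0 q; have := ss_bound q => ? ?; rewrite Rabs_pos_eq.
  by apply: Rmult_le_compat_r.
by apply: Rmult_le_pos => //; lra.
Qed.

Lemma nst_ge0 q : 0 <= nst q.
Proof. by have := nst_ge1 q; lra. Qed.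

Lemma dom_martp (v : state -> vec d) i : (forall q, 1 + n1 (v q) <= nst q) ->
  dom (fun p => martp v p i) (fun p => sp p * nst p.1.1 * gam p).
Proof.
move=> vN; apply: (dom_martc (H := nst)); [exact: nst_ge0|exact: dom_ss_mul nst_ge0| |].
  by move=> j; apply: (dom_v_growth A1 B1 vN (lip_sig j i)).
by move=> j k; apply: (dom_v_h A1 B1 vN).
Qed.

Lemma dom_Wt_s4N (f : state -> R) : (forall q, Rabs (f q) <= nst q) ->
  dom (fun q => ss q ^ 4 * f q ^ 4) Wt.
Proof.
move=> fN; apply: dom_trans dom_Wt_N; apply: dom_le => q.
rewrite -Rpow_mult_distr -RPow_abs; apply: pow_incr; split; first exact: Rabs_pos.
have s0 := ss_gt0 q; rewrite Rabs_mult Rabs_pos_eq; last lra.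
by apply: Rmult_le_compat_l; [lra|].
Qed.

Lemma dom_drift_coef (f : J -> R) (A : state -> R) k : dom f (fun p => A p.1.1) ->
  (forall q, 0 <= A q) ->
  dom (fun p => sp p * sp p * f p) (fun p => sp p * sp p * A p.1.1 * gam p ^ k).
Proof.
move=> H A0.
have h2 : dom (fun p => sp p * sp p) (fun p => sp p * sp p * gam p ^ k).
  apply: dom_le => p; have := gam_pow_ge1 p k; have := sp_gt0 p => s0 g1.
  have ss0 : 0 <= sp p * sp p by nra.
  by rewrite Rabs_pos_eq // -[X in X <= _]Rmult_1_r; apply: Rmult_le_compat_l.
by apply: dom_wider (domM h2 H) => p; apply: Req_le; ring.
Qed.

Lemma dom_gam1 (f : J -> R) g : dom f (fun p => g p * gam p ^ 1) -> dom f (fun p => g p * gam p).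
Proof. by apply: dom_wider => p; rewrite (pow_1 (gam p)); apply: Rle_refl. Qed.

Lemma growth_V_coarse i :
  growth (fun p => sp p ^ 4 * znew p i ^ 4) (fun q => ss q ^ 4 * sz q i ^ 4).
Proof.
apply: (eq_growth (G := fun q => ss q ^ 4 * sz q i ^ 4) (G' := fun p => ss p.1.1 ^ 4 *
   (sz p.1.1 i + (martp sz p i + 2 * ((sp p * sp p) * mu (sz p.1.1) i))) ^ 4)) => //.
  by move=> p; rewrite /znew stepE /martp; congr (_ * _ ^ 4); ring.
apply: (growth_quartic (c := fun q => ss q ^ 4) (u := fun q => sz q i) (A := nst)).
- by move=> q; apply: pow4_ge0.
- exact: nst_ge0.
- exact: noise_mart.
- exact: dom_martp nst_z.
- apply: dom_gam1; apply: domZ; apply: dom_drift_coef nst_ge0.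
  exact: (dom_v_growth A1 B1 nst_z (lip_mu i)).
- apply: dom_Wt_s4N => q; apply: Rle_trans (n1_ge _ i) _.
  by have := nst_z q; lra.
- by apply: dom_Wt_s4N => q; rewrite Rabs_pos_eq; [lra|exact: nst_ge0].
Qed.

Lemma dom_drift_wider (f : J -> R) i n (A : state -> R) j k : (j <= k)%N ->
  dom f (fun p => sp p ^ i.+2 * Np p ^ n * gam p ^ j) -> (forall q, 0 <= A q) ->
  dom (fun q => ss q ^ i * nst q ^ n) A -> dom f (fun p => sp p * sp p * A p.1.1 * gam p ^ k).
Proof.
move=> jk H A0 HA.
have sA0 q : 0 <= ss q * A q by apply: Rmult_le_pos => //; have := ss_gt0 q; lra.
apply: dom_wider (dom_gam_wider (A := fun q => ss q * A q) jk H sA0 _) => [p|].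
  by apply: Req_le; rewrite /sp; ring.
apply: (eq_dom (f' := fun q => ss q * (ss q ^ i * nst q ^ n))).
  by move=> q; rewrite -tech_pow_Rmult; ring.
apply: domM HA; apply: dom_le => q; rewrite Rabs_pos_eq; have := ss_gt0 q; lra.
Qed.

(** * Growth of V and Q along either fine path *)

Section FineSide.
Variables (v : state -> vec d) (a b : J -> vm) (vnew : J -> vec d).
Hypothesis vN : forall q, 1 + n1 (v q) <= nst q.
Hypothesis abg : same_gam a b.
Hypothesis c_levy : forall i, noise (fun p => levyp v a b p i).
Hypothesis c_rem : forall i, noise (fun p => remv v a b p i).
Hypothesis vnewE : forall p i, vnew p i = v p.1.1 i
  + (martp v p i + (levyp v a b p i + remv v a b p i)
     + (2 * (sp p * sp p * mu (v p.1.1) i) + ddrift v a p i)).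

Lemma dom_fine_noise (A : state -> R) i : (forall q, 0 <= A q) ->
  dom (fun q => ss q * nst q) A ->
  dom (fun p => levyp v a b p i + remv v a b p i) (fun p => sp p * A p.1.1 * gam p).
Proof.
move=> A0 HA.
have HA' : dom (fun q => ss q ^ 1 * nst q ^ 1) A by apply: eq_dom HA => q; rewrite !pow_1.
apply: dom_gam1; apply: domD.
  apply: (dom_gam_wider (i := 1) (n := 1) (j := 1)) => //.
  by apply: dom_wider (dom_levyp vN abg i) => p; rewrite (pow_1 (gam p)); apply: Rle_refl.
apply: (dom_gam_wider (i := 1) (n := 1) (j := 1)) => //.
by apply: dom_wider (dom_remv_lin vN abg i) => p; rewrite (pow_1 (gam p)); apply: Rle_refl.
Qed.

Lemma dom_fine_drift (A : state -> R) i : (forall q, 0 <= A q) ->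
  dom (fun q => ss q * nst q) A ->
  dom (fun p => ddrift v a p i) (fun p => sp p * sp p * A p.1.1 * gam p ^ 1).
Proof.
move=> A0 HA; apply: (dom_drift_wider (i := 1) (n := 1) (j := 1)) => //.
  by apply: dom_wider (dom_ddrift vN abg i) => p; rewrite (pow_1 (gam p)); apply: Rle_refl.
by apply: eq_dom HA => q; rewrite !pow_1.
Qed.

Lemma growth_V_fine i :
  growth (fun p => sp p ^ 4 * vnew p i ^ 4) (fun q => ss q ^ 4 * v q i ^ 4).
Proof.
have sN := dom_ss_mul nst_ge0.
apply: (eq_growth (G := fun q => ss q ^ 4 * v q i ^ 4) (G' := fun p => ss p.1.1 ^ 4 *
   (v p.1.1 i + (martp v p i + (levyp v a b p i + remv v a b p i)
     + (2 * (sp p * sp p * mu (v p.1.1) i) + ddrift v a p i))) ^ 4)) => //.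
  by move=> p; rewrite vnewE.
apply: (growth_quartic (c := fun q => ss q ^ 4) (u := fun q => v q i) (A := nst)).
- by move=> q; apply: pow4_ge0.
- exact: nst_ge0.
- by apply: noiseD; [exact: noise_mart|apply: noiseD; [exact: c_levy|exact: c_rem]].
- by apply: domD; [exact: dom_martp vN|exact: dom_fine_noise nst_ge0 sN].
- apply: dom_gam1; apply: domD; last exact: dom_fine_drift nst_ge0 sN.
  apply: domZ; apply: dom_drift_coef nst_ge0.
  exact: (dom_v_growth A1 B1 vN (lip_mu i)).
- apply: dom_Wt_s4N => q; apply: Rle_trans (n1_ge _ i) _.
  by have := vN q; lra.
- by apply: dom_Wt_s4N => q; rewrite Rabs_pos_eq; [lra|exact: nst_ge0].
Qed.

(** The Levy term does not cancel along a single path, but its order s^2 N = s (s N) is that of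
    admissible noise once s N is part of [A]. *)
Lemma growth_Q_fine i : dom (fun q => n1 (vsub (v q) (sz q)) ^ 4) Wt ->
  growth (fun p => (vnew p i - znew p i) ^ 4) (fun q => (v q i - sz q i) ^ 4).
Proof.
move=> HW; pose A q := n1 (vsub (v q) (sz q)) + ss q * nst q.
have sN0 q : 0 <= ss q * nst q.
  by apply: Rmult_le_pos; [have := ss_gt0 q; lra|exact: nst_ge0].
have A0 q : 0 <= A q by rewrite /A; have := sN0 q; have := n1_ge0 (vsub (v q) (sz q)); lra.
have sN : dom (fun q => ss q * nst q) A.
  apply: dom_le => q; rewrite Rabs_pos_eq // /A; have := n1_ge0 (vsub (v q) (sz q)); lra.
have dA g : lip1 g -> dom (fun p : J => g (v p.1.1) - g (sz p.1.1)) (fun p => A p.1.1).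
  move=> gl; apply: dom_wider (dom_lip1 _ _ gl) => p.
  by rewrite /A; have := sN0 p.1.1; lra.
apply: (eq_growth (G := fun q => 1 * (v q i - sz q i) ^ 4) (G' := fun p => 1 *
   ((v p.1.1 i - sz p.1.1 i) + ((martp v p i - martp sz p i + (levyp v a b p i + remv v a b p i))
     + (2 * (sp p * sp p * (mu (v p.1.1) i - mu (sz p.1.1) i)) + ddrift v a p i))) ^ 4)).
- by move=> p; rewrite vnewE /znew stepE Rmult_1_l /martp; congr (_ ^ 4); ring.
- by move=> q; ring.
apply: (growth_quartic (c := fun _ => 1) (u := fun q => v q i - sz q i) (A := A)) => //.
- by move=> q; lra.
- apply: noiseD; first by apply: noiseB; exact: noise_mart.
  by apply: noiseD; [exact: c_levy|exact: c_rem].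
- apply: domD; last exact: dom_fine_noise A0 sN.
  apply: (eq_dom (f' := fun p => \rsum_(j < m)
      ((sig j (v p.1.1) i - sig j (sz p.1.1) i) * (A1 p j + B1 p j))
    + / 2 * \rsum_(j < m) \rsum_(k < m) ((hmil j k i (v p.1.1) - hmil j k i (sz p.1.1))
        * qvar (2 * (sp p * sp p)) (fun j => A1 p j + B1 p j) j k))) => [p|].
    have E1 : \rsum_(j < m) ((sig j (v p.1.1) i - sig j (sz p.1.1) i) * (A1 p j + B1 p j))
      = \rsum_(j < m) (sig j (v p.1.1) i * (A1 p j + B1 p j))
        - \rsum_(j < m) (sig j (sz p.1.1) i * (A1 p j + B1 p j)).
      by rewrite -rsumB; apply: eq_bigr => j _; ring.
    have E2 (q : 'I_m -> 'I_m -> R) :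
      \rsum_(j < m) \rsum_(k < m) ((hmil j k i (v p.1.1) - hmil j k i (sz p.1.1)) * q j k)
      = \rsum_(j < m) \rsum_(k < m) (hmil j k i (v p.1.1) * q j k)
        - \rsum_(j < m) \rsum_(k < m) (hmil j k i (sz p.1.1) * q j k).
      by rewrite -rsum2B; apply: eq_bigr => j _; apply: eq_bigr => k _; ring.
    by rewrite E1 E2 /martp /mart; ring.
  (* The two [hmil] values are bounded separately: their extra [s] already turns [nst] into part of
     [A]. *)
  apply: (dom_martc (H := nst)) => // [j|j k]; first exact: (dA _ (lip_sig j i)).
  by apply: domB; [exact: (dom_v_h A1 B1 vN)|exact: (dom_v_h A1 B1 nst_z)].
- apply: dom_gam1; apply: domD; last exact: dom_fine_drift A0 sN.
  by apply: domZ; apply: dom_drift_coef A0; exact: (dA _ (lip_mu i)).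
- apply: dom_trans HW; apply: dom_le => q; rewrite Rmult_1_l -RPow_abs.
  by apply: pow_incr; split; [exact: Rabs_pos|exact: (n1_ge (vsub (v q) (sz q)) i)].
- apply: (eq_dom (f' := fun q => A q ^ 4)); first by move=> q; ring.
  by apply: dom_pow4D HW dom_Wt_N.
Qed.
End FineSide.

Lemma xnewE p i : xnew p i = sx p.1.1 i
  + (martp sx p i + (levyp sx A1 B1 p i + remv sx A1 B1 p i)
     + (2 * (sp p * sp p * mu (sx p.1.1) i) + ddrift sx A1 p i)).
Proof.
by rewrite /xnew two_steps /martp /levyp /remv /remp /ddrift /half; ring.
Qed.

Lemma ynewE p i : ynew p i = sy p.1.1 i
  + (martp sy p i + (levyp sy B1 A1 p i + remv sy B1 A1 p i)
     + (2 * (sp p * sp p * mu (sy p.1.1) i) + ddrift sy B1 p i)).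
Proof.
rewrite /ynew two_steps /martp.
have -> : (fun j => B1 p j + A1 p j) = (fun j => A1 p j + B1 p j).
  by apply: functional_extensionality => j; ring.
by rewrite /levyp /remv /remp /ddrift /half; ring.
Qed.

Lemma znewE p i : znew p i = sz p.1.1 i
  + (martp sz p i + 2 * (sp p * sp p * mu (sz p.1.1) i)).
Proof. by rewrite /znew stepE /martp; ring. Qed.

Lemma noise_levy_x i : noise (fun p => levyp sx A1 B1 p i).
Proof. exact: noise_levy. Qed.
Lemma noise_levy_y i : noise (fun p => levyp sy B1 A1 p i).
Proof. exact: (noise_swap (noise_levy sy i)). Qed.
Lemma noise_rem_x i : noise (fun p => remv sx A1 B1 p i).
Proof. exact: noise_rem. Qed.
Lemma noise_rem_y i : noise (fun p => remv sy B1 A1 p i).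
Proof. exact: (noise_swap (noise_rem sy i)). Qed.
Lemma noise_drift_x i : noise (fun p => driftm sx A1 p i).
Proof. exact: noise_drift. Qed.
Lemma noise_drift_y i : noise (fun p => driftm sy B1 p i).
Proof. exact: (noise_swap (noise_drift sy i)). Qed.

(** The core of the antithetic argument. [A] collects what may appear with a square controlled by
    [Wt]: the midpoint error, Q^2 and (s N)^2, where Q here denotes a distance. Averages of [sig]
    and [mu] cost the first two, differences of [hmil] cost s N Q, and the remainders cost (s
    N)^2. *)
Lemma growth_P i : growth (fun p => (/ 2 * (xnew p i + ynew p i) - znew p i) ^ 2)
                    (fun q => (/ 2 * (sx q i + sy q i) - sz q i) ^ 2).
Proof.
pose Q q := n1 (vsub (sx q) (sz q)) + n1 (vsub (sy q) (sz q)).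
pose A q := n1 (mid q) + Q q ^ 2 + (ss q * nst q) ^ 2.
have Q0 q : 0 <= Q q.
  by rewrite /Q; have := n1_ge0 (vsub (sx q) (sz q)); have := n1_ge0 (vsub (sy q) (sz q)); lra.
have e0 q : 0 <= n1 (mid q) by apply: n1_ge0.
have A0 q : 0 <= A q.
  by rewrite /A; have := e0 q; have := pow2_ge_0 (Q q); have := pow2_ge_0 (ss q * nst q); lra.
have xyQ q : n1 (vsub (sx q) (sy q)) <= Q q.
  apply: n1_triang => k; rewrite /vsub.
  have := Rabs_triang (sx q k - sz q k) (sz q k - sy q k); rewrite (Rabs_minus_sym (sz q k)).
  by have -> : sx q k - sz q k + (sz q k - sy q k) = sx q k - sy q k by [ring].
(* Young: s N Q is below Q^2 + (s N)^2. *)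
have sNQ : dom (fun q => ss q * (nst q * Q q)) A.
  apply: dom_le => q; have s0 := ss_gt0 q; have N0 := nst_ge0 q.
  have p0 : 0 <= ss q * nst q by apply: Rmult_le_pos; lra.
  rewrite -Rmult_assoc Rabs_pos_eq; last by apply: Rmult_le_pos.
  by rewrite /A; have := pow2_ge_0 (ss q * nst q - Q q); have := e0 q;
    have := Rmult_le_pos _ _ p0 (Q0 q); nra.
have s2N2 : dom (fun q => ss q ^ 2 * nst q ^ 2) A.
  apply: dom_le => q; rewrite -Rpow_mult_distr Rabs_pos_eq; last exact: pow2_ge_0.
  by rewrite /A; have := e0 q; have := pow2_ge_0 (Q q); lra.
have dmid g G : lip1 g -> taylor2 g G ->
    dom (fun p : J => / 2 * (g (sx p.1.1) + g (sy p.1.1)) - g (sz p.1.1)) (fun p => A p.1.1).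
  move=> gl gt; have [K [K0 HK]] := midpoint_bound gl gt; exists K; split=> // p.
  apply: Rle_trans (HK (sx p.1.1) (sy p.1.1) (sz p.1.1)) _; apply: Rmult_le_compat_l => //.
  rewrite /A -/(mid p.1.1); have h := xyQ p.1.1; have n0 := n1_ge0 (vsub (sx p.1.1) (sy p.1.1)).
  have := pow2_ge_0 (ss p.1.1 * nst p.1.1); have := e0 p.1.1.
  have := Rmult_le_compat _ _ _ _ n0 n0 h h.
  by rewrite -Rsqr_def Rsqr_pow2 -Rsqr_def Rsqr_pow2; lra.
have dh (u v : state -> vec d) j k : (forall q, 1 + n1 (v q) <= nst q) ->
    (forall q, n1 (vsub (u q) (v q)) <= Q q) ->
    dom (fun p : J => hmil j k i (u p.1.1) - hmil j k i (v p.1.1))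
        (fun p => nst p.1.1 * Q p.1.1).
  move=> vN uvQ.
  apply: dom_wider (dom_dh sp A1 B1 (x := fun p : J => v p.1.1) (N := fun p : J => nst p.1.1)
     (fun p => vN p.1.1) j k i (fun p => u p.1.1)) => p.
  by apply: Rmult_le_compat_l; [exact: nst_ge0|exact: uvQ].
have xzQ q : n1 (vsub (sx q) (sz q)) <= Q q.
  by rewrite /Q; have := n1_ge0 (vsub (sy q) (sz q)); lra.
have yzQ q : n1 (vsub (sy q) (sz q)) <= Q q.
  by rewrite /Q; have := n1_ge0 (vsub (sx q) (sz q)); lra.
have wid (f : J -> R) : dom f (fun p => sp p * A p.1.1 * gam p) ->
    dom f (fun p => sp p * A p.1.1 * gam p ^ 2).
  apply: dom_wider => p; apply: Rmult_le_compat_l.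
    by apply: Rmult_le_pos => //; have := sp_gt0 p; lra.
  by have := gam_ge1 p; nra.
(* [driftm] is added to the noise and subtracted from the drift, which leaves a true drift of order
   s^4. *)
apply: (eq_growth (G := fun q => (mid q i) ^ 2) (G' := fun p => (mid p.1.1 i +
  (((/ 2 * (martp sx p i + martp sy p i) - martp sz p i)
    + / 2 * (levyp sx A1 B1 p i + levyp sy B1 A1 p i)
    + / 2 * (remv sx A1 B1 p i + remv sy B1 A1 p i)
    + / 2 * (driftm sx A1 p i + driftm sy B1 p i))
  + (2 * (sp p * sp p * (/ 2 * (mu (sx p.1.1) i + mu (sy p.1.1) i) - mu (sz p.1.1) i))
    + / 2 * ((ddrift sx A1 p i - driftm sx A1 p i) + (ddrift sy B1 p i - driftm sy B1 p i))))) ^ 2)) => //.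
  by move=> p; rewrite xnewE ynewE znewE /mid; congr (_ ^ 2); field.
apply: (growth_square (u := fun q => mid q i) (A := A)) => //.
- apply: noiseD; last by apply: noiseZc; apply: noiseD; [exact: noise_drift_x|exact: noise_drift_y].
  apply: noiseD; last by apply: noiseZc; apply: noiseD; [exact: noise_rem_x|exact: noise_rem_y].
  apply: noiseD; last by apply: noiseZc; apply: noiseD; [exact: noise_levy_x|exact: noise_levy_y].
  by apply: noiseB; [apply: noiseZc; apply: noiseD|]; exact: noise_mart.
- apply: domD; last first.
    apply: domZ; apply: domD; apply: (dom_gam_wider (i := 2) (n := 2) (j := 2)) => //.
      exact: (dom_driftm nst_x same_gam_ab i).
    exact: (dom_driftm nst_y same_gam_ba i).
  apply: domD; last first.
    apply: domZ; apply: domD; apply: (dom_gam_wider (i := 2) (n := 2) (j := 2)) => //.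
      exact: (dom_remv nst_x same_gam_ab i).
    exact: (dom_remv nst_y same_gam_ba i).
  apply: wid; apply: domD.
    apply: (eq_dom (f' := fun p => \rsum_(j < m)
        ((/ 2 * (sig j (sx p.1.1) i + sig j (sy p.1.1) i) - sig j (sz p.1.1) i) * (A1 p j + B1 p j))
      + / 2 * \rsum_(j < m) \rsum_(k < m)
        ((/ 2 * (hmil j k i (sx p.1.1) - hmil j k i (sz p.1.1))
           + / 2 * (hmil j k i (sy p.1.1) - hmil j k i (sz p.1.1)))
          * qvar (2 * (sp p * sp p)) (fun j => A1 p j + B1 p j) j k))) => [p|].
      have E1 : \rsum_(j < m) ((/ 2 * (sig j (sx p.1.1) i + sig j (sy p.1.1) i) - sig j (sz p.1.1) i) * (A1 p j + B1 p j))
        = / 2 * (\rsum_(j < m) (sig j (sx p.1.1) i * (A1 p j + B1 p j))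
          + \rsum_(j < m) (sig j (sy p.1.1) i * (A1 p j + B1 p j)))
          - \rsum_(j < m) (sig j (sz p.1.1) i * (A1 p j + B1 p j)).
        by rewrite -rsumD -rsumZ -rsumB; apply: eq_bigr => j _; ring.
      have E2 (q : 'I_m -> 'I_m -> R) :
        \rsum_(j < m) \rsum_(k < m) ((/ 2 * (hmil j k i (sx p.1.1) - hmil j k i (sz p.1.1))
             + / 2 * (hmil j k i (sy p.1.1) - hmil j k i (sz p.1.1))) * q j k)
        = / 2 * (\rsum_(j < m) \rsum_(k < m) (hmil j k i (sx p.1.1) * q j k)
           + \rsum_(j < m) \rsum_(k < m) (hmil j k i (sy p.1.1) * q j k))
          - \rsum_(j < m) \rsum_(k < m) (hmil j k i (sz p.1.1) * q j k).
        rewrite -rsum2D -rsumZ -rsumB; apply: eq_bigr => j _.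
        by rewrite -rsumZ -rsumB; apply: eq_bigr => k _; field.
      by rewrite E1 E2 /martp /mart; field.
    apply: (dom_martc (H := fun q => nst q * Q q)) => // [j|j k].
      exact: (dmid _ _ (lip_sig j i) (tay_sig j i)).
    by apply: domD; apply: domZ; apply: dh => //; exact: nst_z.
  have s2g0 p : 0 <= sp p * gam p.
    by apply: Rmult_le_pos; [have := sp_gt0 p|have := gam_ge1 p]; lra.
  (* Antithetic cancellation: the area seen by [y] is minus that seen by [x], so only the difference
     of the coefficients survives. *)
  apply: domZ; apply: (eq_dom (f' := fun p => / 2 * \rsum_(j < m) \rsum_(k < m)
     ((hmil j k i (sx p.1.1) - hmil j k i (sy p.1.1)) * (A1 p k * B1 p j - A1 p j * B1 p k)))) => [p|].
    rewrite /levyp /levy -Rmult_plus_distr_l -rsum2D; congr (_ * _).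
    by apply: eq_bigr => j _; apply: eq_bigr => k _; ring.
  have g0 p : 0 <= sp p * A p.1.1 * gam p.
    by have := sAgam_ge0 1 (A0 p.1.1); rewrite pow_1.
  apply: domZ; apply: dom_sum => // j; apply: dom_sum => // k.
  apply: dom_trans (domM (dh _ _ j k nst_y xyQ) (dom_area_gam j k)) _.
  apply: (eq_dom (f' := fun p => ss p.1.1 * (nst p.1.1 * Q p.1.1) * (sp p * gam p))).
    by move=> p; rewrite /sp; ring.
  by apply: dom_wider (dom_lift s2g0 sNQ) => p; apply: Req_le; ring.
- apply: domD.
    by apply: domZ; apply: dom_drift_coef A0; exact: (dmid _ _ (lip_mu i) (tay_mu i)).
  apply: domZ; apply: domD; apply: (dom_drift_wider (i := 2) (n := 2) (j := 2)) => //.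
    exact: (dom_driftb nst_x same_gam_ab i).
  exact: (dom_driftb nst_y same_gam_ba i).
- apply: dom_trans dom_Wt_mid; apply: dom_le => q.
  by rewrite -RPow_abs; apply: pow_incr; split; [exact: Rabs_pos|exact: n1_ge].
- apply: dom_pow2D; last by apply: eq_dom dom_Wt_N => q; ring.
  apply: dom_pow2D dom_Wt_mid _.
  by apply: eq_dom (dom_pow4D dom_Wt_xz dom_Wt_yz) => q; rewrite /Q; ring.
Qed.

(** * The one-step inequality for the whole Lyapunov function *)

Definition lyapunov_new p := lyapunov (sp p) (xnew p) (ynew p) (znew p).

Lemma growth_lyapunov : growth lyapunov_new Wt.
Proof.
have sc (F' : J -> R) (F : state -> R) : (forall p, F' p = F p.1.1) -> growth F' F.
  move=> E; exists 0, (fun _ => 0 * 0); split; first lra; split.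
    by move=> W X Y G q W0 GX GY; rewrite /centered -[RHS](EE_cst X Y W0 0); apply: eq_EE => *; ring.
  by move=> p; rewrite E; lra.
have sV (v : state -> vec d) (vnew : J -> vec d) :
    (forall i, growth (fun p => sp p ^ 4 * vnew p i ^ 4) (fun q => ss q ^ 4 * v q i ^ 4)) ->
    growth (fun p => sp p ^ 4 * (\rsum_(i < d) vnew p i ^ 4))
        (fun q => ss q ^ 4 * (\rsum_(i < d) v q i ^ 4)).
  by move=> H; apply: eq_growth (growth_sum H) => [p|q]; rewrite rsumZ.
apply: (eq_growth (G' := fun p =>
   \rsum_(i < d) (/ 2 * (xnew p i + ynew p i) - znew p i) ^ 2
   + \rsum_(i < d) (xnew p i - znew p i) ^ 4 + \rsum_(i < d) (ynew p i - znew p i) ^ 4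
   + (sp p ^ 4 * 1 + sp p ^ 4 * (\rsum_(i < d) xnew p i ^ 4)
      + sp p ^ 4 * (\rsum_(i < d) ynew p i ^ 4) + sp p ^ 4 * (\rsum_(i < d) znew p i ^ 4)))
  (G := fun q => \rsum_(i < d) (/ 2 * (sx q i + sy q i) - sz q i) ^ 2
   + \rsum_(i < d) (sx q i - sz q i) ^ 4 + \rsum_(i < d) (sy q i - sz q i) ^ 4
   + (ss q ^ 4 * 1 + ss q ^ 4 * (\rsum_(i < d) sx q i ^ 4)
      + ss q ^ 4 * (\rsum_(i < d) sy q i ^ 4) + ss q ^ 4 * (\rsum_(i < d) sz q i ^ 4)))).
- by move=> p; rewrite /lyapunov_new /lyapunov; ring.
- by move=> q; rewrite /Wt /lyapunov; ring.
apply: growthD; last first.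
  apply: growthD; last by apply: sV => i; exact: growth_V_coarse.
  apply: growthD; last by apply: sV => i; exact: (growth_V_fine nst_y same_gam_ba noise_levy_y noise_rem_y ynewE).
  apply: growthD; last by apply: sV => i; exact: (growth_V_fine nst_x same_gam_ab noise_levy_x noise_rem_x xnewE).
  by apply: sc.
apply: growthD; last first.
  by apply: growth_sum => i; exact: (growth_Q_fine nst_y same_gam_ba noise_levy_y noise_rem_y ynewE i dom_Wt_yz).
apply: growthD; last first.
  by apply: growth_sum => i; exact: (growth_Q_fine nst_x same_gam_ab noise_levy_x noise_rem_x xnewE i dom_Wt_xz).
by apply: growth_sum => i; exact: growth_P.
Qed.

Lemma payoff_bound f G : lip1 f -> taylor2 f G -> exists K, 0 <= K /\
  forall q, (/ 2 * (f (sx q) + f (sy q)) - f (sz q)) ^ 2 <= K * Wt q.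
Proof.
move=> fl ft; have [K [K0 HK]] := midpoint_bound fl ft.
pose Q q := n1 (vsub (sx q) (sz q)) + n1 (vsub (sy q) (sz q)).
have [C [C0 HC]] : dom (fun q => (Q q ^ 2 + n1 (mid q)) ^ 2) Wt.
  apply: dom_pow2D dom_Wt_mid.
  by apply: eq_dom (dom_pow4D dom_Wt_xz dom_Wt_yz) => q; rewrite /Q; ring.
exists (K ^ 2 * C); split=> [|q]; first by apply: Rmult_le_pos => //; apply: pow2_ge_0.
have h : Rabs (/ 2 * (f (sx q) + f (sy q)) - f (sz q)) <= K * (Q q ^ 2 + n1 (mid q)).
  apply: Rle_trans (HK _ _ _) _; apply: Rmult_le_compat_l => //.
  apply: Rplus_le_compat_r; rewrite -Rsqr_def Rsqr_pow2; apply: pow_incr.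
  split; first exact: n1_ge0.
  apply: n1_triang => k; rewrite /vsub (Rabs_minus_sym (sy q k) (sz q k)).
  have -> : sx q k - sy q k = (sx q k - sz q k) + (sz q k - sy q k) by ring.
  exact: Rabs_triang.
rewrite -pow2_abs; apply: Rle_trans (pow_incr _ _ 2 (conj (Rabs_pos _) h)) _.
rewrite Rpow_mult_distr Rmult_assoc; apply: Rmult_le_compat_l; first exact: pow2_ge_0.
exact: Rle_trans (Rle_abs _) (HC q).
Qed.
End Coupled.

(** Taking expectations kills the noise of [growth_lyapunov], and [gam ^ 4] integrates to at most
    [G * G]. [C] is fixed before the laws, the step and the paths. *)
Lemma lyapunov_step (S G : R) : exists C, 0 <= C /\
  forall (W : finType) (X Y : W -> 'I_m -> R) (s : R) (x y z : vec d),
  (0 < #|W|)%N -> 0 < s -> s <= S -> good_increment s X G -> good_increment s Y G ->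
  EE X Y (fun a b => lyapunov s (step (s * s) (step (s * s) x a) b)
    (step (s * s) (step (s * s) y b) a) (step (2 * (s * s)) z (fun j => a j + b j)))
  <= (1 + C * (s * s)) * lyapunov s x y z.
Proof.
have [C [M [C0 [cM H]]]] := growth_lyapunov S; exists (C * (G * G)).
split; first by apply: Rmult_le_pos => //; nra.
move=> W X Y s x y z W0 s0 sS GX GY; pose q := State x y z s0 sS.
apply: (@Rle_trans _ (EE X Y (fun a b => (lyapunov s x y z + M (q, a, b))
   + C * (s * s) * lyapunov s x y z * (alpha s a ^ 8 * alpha s b ^ 8)))).
  apply: EE_le => // a b; apply: Rle_trans (H (q, a, b)) _; rewrite /gam.
  by apply: Req_le; rewrite /Wt; cbn -[pow alpha lyapunov]; ring.
rewrite EED EEZ EED EE_cst // (cM _ _ _ G q) //.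
have h := EE_alpha8 W0 GX GY.
have W0' : 0 <= lyapunov s x y z by exact: (Wt_ge0 q).
have : C * (s * s) * lyapunov s x y z * EE X Y (fun a b => alpha s a ^ 8 * alpha s b ^ 8)
    <= C * (s * s) * lyapunov s x y z * (G * G).
  by apply: Rmult_le_compat_l => //; apply: Rmult_le_pos => //; apply: Rmult_le_pos => //; nra.
lra.
Qed.
End Trajectory.

(** * The multilevel estimate *)

Lemma eq_milstein d m mu sig dsig D (X0 : vec d) (incr incr' : nat -> 'I_m -> R) n :
  (forall k, (k < n)%N -> incr k = incr' k) ->
  milstein mu sig dsig D X0 incr n = milstein mu sig dsig D X0 incr' n.
Proof.
elim: n => [//|n IH] H /=; rewrite IH; first by rewrite H.
by move=> k kn; apply: H; apply: ltnW.
Qed.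

Section Coupling.
Variables (d m : nat) (mu : vec d -> vec d) (sig : 'I_m -> vec d -> vec d).
Variables (dsig : 'I_m -> vec d -> 'I_d -> 'I_d -> R) (X0 : vec d) (T : R) (L l : nat).
Let D := stepsize T l.
Let Om := Omega L m.
Let step := milstein_step mu sig dsig.

Definition coupled n (w : Om) : vec d * vec d * vec d :=
  (milstein mu sig dsig D X0 (xif T l w) (2 * n),
   milstein mu sig dsig D X0 (xia T l w) (2 * n),
   milstein mu sig dsig (2 * D) X0 (xic T l w) n).

Definition coupled_step (u : vec d * vec d * vec d) (a b : 'I_m -> R) :=
  (step D (step D u.1.1 a) b, step D (step D u.1.2 b) a,
   step (2 * D) u.2 (fun j => a j + b j)).

Lemma coupledS n w :
  coupled n.+1 w = coupled_step (coupled n w) (xif T l w (2 * n)) (xif T l w (2 * n).+1).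
Proof.
(* Indices start at 0, so a coarse step pairs an even index with its successor. *)
have E : xia T l w (2 * n) = xif T l w (2 * n).+1 by rewrite /xia mul2n odd_double.
have E' : xia T l w (2 * n).+1 = xif T l w (2 * n) by rewrite /xia mul2n /= odd_double.
by rewrite /coupled mulnS /coupled_step /= E E'.
Qed.

Lemma coupled_past n (w w' : Om) :
  (forall i, (i < 2 * n)%N -> xif T l w i = xif T l w' i) -> coupled n w = coupled n w'.
Proof.
move=> H; congr (_, _, _); apply: eq_milstein => k kn; first exact: H.
- rewrite /xia -/(xif T l w _) -/(xif T l w' _); apply: H.
  case: ifP => ok; first by apply: leq_ltn_trans kn; apply: leq_pred.
  (* For even [k], parity excludes [k.+1 = 2 * n]: the exchange never leaves its coarse step. *)
  rewrite ltn_neqAle kn andbT; apply: contraFneq ok => ek.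
  by move: (congr1 odd ek); rewrite /= mul2n odd_double => /negbFE.
- have k2 : ((2 * k).+1 < 2 * n)%N by rewrite !mul2n -doubleS -ltnS ltnS leq_double.
  by apply: functional_extensionality => j; rewrite /xic !H // ltnW.
Qed.
End Coupling.

Theorem theorem1 (d m : nat) (T : R) (mu : vec d -> vec d)
  (sig : 'I_m -> vec d -> vec d) (dsig : 'I_m -> vec d -> 'I_d -> 'I_d -> R)
  (f : vec d -> R) (X0 : vec d) :
  0 < T ->
  (forall i, exists G, C2b_grad (fun x => mu x i) G) ->
  (forall j i, C2b_grad (fun x => sig j x i) (fun x => dsig j x i)) ->
  lipschitz f ->
  (exists G, C2_grad_bdd2 f G) ->
  exists C : R, forall L l : nat, (1 <= l <= L)%N ->
    let Y := fun w : Omega L m =>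
      Pfine mu sig dsig f X0 T l w - Pcoarse mu sig dsig f X0 T l w in
    Variance Y <= Expect (fun w => Y w ^ 2) /\
    Expect (fun w => Y w ^ 2) <= C * stepsize T l ^ 2.
Proof.
move=> T0 /fin_all_exists [gmu hmu] hsig /lipschitz_lip1 lf [Gf /C2_taylor2 [tf _]].
have lip_mu i : lip1 (fun x => mu x i).
  by have [[g _] b] := hmu i; exact: lip1_bounded_grad g b.
have lip_sig j i : lip1 (fun x => sig j x i).
  by have [[g _] b] := hsig j i; exact: lip1_bounded_grad g b.
have tay_mu i : taylor2 (fun x => mu x i) (gmu i) by have [/C2_taylor2 []] := hmu i.
have tay_sig j i : taylor2 (fun x => sig j x i) (fun x => dsig j x i).
  by have [/C2_taylor2 []] := hsig j i.
have lip_dsig j i p : lip1 (fun x => dsig j x i p) by have [/C2_taylor2 []] := hsig j i.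
have bnd_gmu i k : bounded_fun (fun x => gmu i x k) by have [_] := hmu i.
have bnd_dsig j i p : bounded_fun (fun x => dsig j x i p) by have [_] := hsig j i.
have [G HG] := xif_good m.
(* [sqrt T] bounds s = sqrt (Delta_l) at every level, so [C] and [K] serve all levels. *)
have [C [C0 HC]] := lyapunov_step lip_mu tay_mu bnd_gmu lip_sig tay_sig lip_dsig bnd_dsig (sqrt T) G.
have [K [K0 HK]] := payoff_bound (sqrt T) lf tf.
pose V0 := 1 + \rsum_(i < d) X0 i ^ 4 + \rsum_(i < d) X0 i ^ 4 + \rsum_(i < d) X0 i ^ 4.
(* [K] converts the Lyapunov function into the squared payoff, the exponential is the Gronwall
   factor, and [V0] is the initial value of V. *)
exists (K * (exp (C * T) * V0)) => L l /andP[l1 lL] Y.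
have W0 : (0 < #|{: Omega L m}|)%N := card_signs_gt0 _.
split; first exact: variance_le.
set D := stepsize T l; pose s := sqrt D.
have D0 : 0 < D := stepsize_gt0 T0 l.
have ss : s * s = D by apply: sqrt_sqrt; lra.
have s0 : 0 < s by apply: sqrt_lt_R0.
have DT : D * 2 ^ l = T by rewrite /D /stepsize; field; apply: pow_nonzero; lra.
have D2 : stepsize T l.-1 = 2 * D.
  rewrite /D /stepsize -[in RHS](prednK l1) -tech_pow_Rmult; field.
  by apply: pow_nonzero; lra.
have sT : s <= sqrt T.
  by apply: sqrt_le_1_alt; have := pow_R1_Rle 2 l ltac:(lra); nra.
pose lyap (u : vec d * vec d * vec d) := lyapunov s u.1.1 u.1.2 u.2.
pose U := @coupled d m mu sig dsig X0 T L l.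
have lyap0 u : 0 <= lyap u by exact: (Wt_ge0 (State u.1.1 u.1.2 u.2 s0 sT)).
have grow n : (n <= 2 ^ l.-1)%N ->
    avg (fun w => lyap (U n w)) <= exp (C * D * INR n) * (D ^ 2 * V0).
  elim: n => [_|n IH nl].
    rewrite Rmult_0_r exp_0 Rmult_1_l; apply: Req_le.
    rewrite -[RHS](avg_cst W0); apply: eq_avg => w.
    have -> : lyap (U 0%N w) = lyapunov s X0 X0 X0 by [].
    rewrite /lyapunov.
    have Z p (F : 'I_d -> R) : (forall i, F i = 0) -> \rsum_(i < d) F i ^ p.+1 = 0.
      by move=> F0; apply: big1 => i _; rewrite F0 pow_i //; apply/ltP.
    have -> : D ^ 2 = s ^ 4 by rewrite -ss; ring.
    rewrite (Z 1%N (fun i => / 2 * (X0 i + X0 i) - X0 i)) => [|i]; last by field.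
    rewrite (Z 3%N (fun i => X0 i - X0 i)) => [|i]; last by ring.
    by rewrite /V0; ring.
  have il : ((2 * n).+1 < 2 ^ l)%N.
    by rewrite -(prednK l1) expnS mul2n mul2n -doubleS leq_double.
  (* Conditioning on the state after [n] coarse steps; the next two fine increments become fresh
     copies, as [lyapunov_step] expects. *)
  have -> : avg (fun w => lyap (U n.+1 w)) = avg (fun w => avg (fun w' : Omega L m => avg (fun w'' : Omega L m =>
      lyap (coupled_step mu sig dsig T l (U n w) (xif T l w' (2 * n)) (xif T l w'' (2 * n).+1))))).
    rewrite -(avg_two_blocks (fun u a b => lyap (coupled_step mu sig dsig T l u a b))
      (U := U n) (i := (2 * n)%N)); last exact: coupled_past.
    by apply: eq_avg => w; rewrite /U coupledS.
  apply: (@Rle_trans _ (avg (fun w => (1 + C * D) * lyap (U n w)))).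
    apply: avg_le => // w; rewrite -ss.
    have := HC (Omega L m) (fun w : Omega L m => xif T l w (2 * n)) (fun w : Omega L m => xif T l w (2 * n).+1)
      s (U n w).1.1 (U n w).1.2 (U n w).2 W0 s0 sT.
    by rewrite /coupled_step -/D -ss; apply; apply: HG => //; apply: ltnW.
  rewrite avgZ S_INR.
  have -> : exp (C * D * (INR n + 1)) = exp (C * D) * exp (C * D * INR n).
    by rewrite -exp_plus; congr exp; ring.
  rewrite Rmult_assoc; apply: Rmult_le_compat.
  - by have := Rmult_le_pos _ _ C0 (Rlt_le _ _ D0); lra.
  - by apply: avg_ge0.
  - exact: exp_ineq1_le.
  - by apply: IH; apply: ltnW.
apply: (@Rle_trans _ (avg (fun w => K * lyap (U (2 ^ l.-1)%N w)))).
  apply: avg_le => // w.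
  have := HK (State (U (2 ^ l.-1)%N w).1.1 (U (2 ^ l.-1)%N w).1.2 (U (2 ^ l.-1)%N w).2 s0 sT).
  by rewrite /Y /Pfine /Pcoarse /U /coupled /Wt /= -expnS prednK // D2 -/D.
rewrite avgZ !Rmult_assoc; apply: Rmult_le_compat_l => //.
apply: Rle_trans (grow _ (leqnn _)) _.
have V00 : 0 <= V0 by rewrite /V0; have := rsum_pow4_ge0 X0; lra.
have -> : exp (C * T) * (V0 * D ^ 2) = exp (C * T) * (D ^ 2 * V0) by ring.
apply: Rmult_le_compat_r; first by apply: Rmult_le_pos => //; apply: pow2_ge_0.
(* The 2^(l-1) coarse steps are counted against the fine step [D], so the product is in fact
   [C * T / 2]. *)
have e : C * D * INR (2 ^ l.-1) <= C * T.
  rewrite INR_expn2 Rmult_assoc; apply: Rmult_le_compat_l => //.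
  rewrite -DT -[in X in _ <= X](prednK l1) -tech_pow_Rmult.
  by have := pow_lt 2 l.-1 ltac:(lra); nra.
by case: e => [/exp_increasing/Rlt_le|->]; [|apply: Rle_refl].
Qed.
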